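(* Let $A:=(V,m_2)$ be a strictly graded commutative algebra and let $m\in\mathcal C_n(A)$ be an extendable $C_n$-structure. Then $H^{n,2}_{\mathrm{Harr}}(A,A)$ acts freely and transitively on $\mathcal E_n(m)$ by $$H^{n,2}_{\mathrm{Harr}}(A,A)\times\mathcal E_n(m)\to\mathcal E_n(m),\qquad(\xi_n,m_n)\mapsto m_n+\xi_n.$$
   Context: Conventions. $\mathbb K$ is an evenly graded commutative ring containing $\mathbb Q$; modules are graded $\mathbb K$-modules, cohomologically graded, with the Koszul sign rule. $(\Sigma V)^i=V^{i+1}$, $(\Sigma^{-1}V)^i=V^{i-1}$; $\Sigma V^*$ means $\mathrm{Hom}_{\mathbb K}(\Sigma V,\mathbb K)$. Profinite modules are inverse limits of free modules of finite rank. For $W$ profinite, $\widehat TW=\prod_{i\ge0}W^{\hat\otimes i}$ and $\widehat LW\subset\widehat TW$ is the Lie subalgebra of convergent (possibly infinite) linear combinations of Lie monomials. Vector field = continuous derivation; diffeomorphism = invertible continuous homomorphism; $\mathrm{Der}(X)$, $\mathrm{Aut}(X)$ are the Lie algebra and group of these. Elements of $W^{\hat\otimes n}$ have order $n$; an endomorphism of $\widehat LW$ has order $n$ if it takes elements of order $i$ to elements of order $i+n-1$. $(n)$ denotes the module of continuous endomorphisms of $\widehat L\Sigma V^*$ of order $\ge n$. A diffeomorphism is pointed if it is of the form $\mathrm{id}+\phi_2+\phi_3+\cdots$ with $\phi_i$ an endomorphism of order $i$. Minimal $C_n$-structures. Let $V$ be a free graded module, $n\ge3$. A minimal $C_n$-structure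 on $V$ is a vector field $m\in\mathrm{Der}(\widehat L\Sigma V^* )$ of degree one of the form $m=m_2+\dots+m_{n-1}$, $m_i$ of order $i$, with $m^2=0\mod(n+1)$. Its part $m_2$ determines a strictly graded commutative algebra $(V,m_2)$; conversely strictly graded commutative algebra structures on $V$ are given by vector fields $m_2$ of order 2 and degree one with $m_2^2=0$. Two minimal $C_n$-structures $m,m'$ are equivalent if there is a pointed diffeomorphism $\phi$ (of degree zero) with $\phi\circ m\circ\phi^{-1}=m'\mod(n)$. $\mathcal C_n(A)$ is the set of minimal $C_n$-structures on $V$ with quadratic part the given $m_2$ modulo equivalence. Extensions. A minimal $C_n$-structure $m=m_2+\dots+m_{n-1}$ is extendable if there is a vector field $m_n$ of order $n$ and degree one such that $m+m_n$ is a minimal $C_{n+1}$-structure; $m_n$ is called an extension of $m$. Two extensions $m_n,m_n'$ are equivalent if there is a diffeomorphism of the form $\phi=\mathrm{id}+\phi_{n-1}+\phi_n+\cdots$ ($\phi_i$ of order $i$; degree zero) with $\phi\circ(m+m_n)\circ\phi^{-1}=m+m_n'\mod(n+1)$. $\mathcal E_n(m)$ is the set of extensions of $m$ modulo equivalence. Harrison cohomology. $C^\bullet_{\mathrm{Harr}}(A,A)=\Sigma^{-1}\mathrm{Der}(\widehat L\Sigma V^* )$ with differential $\xi\mapsto[m_2,\xi]$; $\xi$ has bidegree $(i,j)$ if it is a vector field of order $i$ and has degree $j$ in $\Sigma^{-1}\mathrm{Der}$ (i.e. degree $j-1$ as a vector field). The differential has bidegree $(1,1)$, and $H^{ij}_{\mathrm{Harr}}(A,A)$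 is the resulting bigraded cohomology. *)

(* Defs.v *)
From HB Require Import structures.
From mathcomp Require Import all_boot all_order all_algebra.
From mathcomp Require Import boolp functions.

Set Implicit Arguments.
Unset Strict Implicit.
Unset Printing Implicit Defensive.

Import GRing.Theory.
Local Open Scope ring_scope.
Local Open Scope quotient_scope.

(* Internal direct sum decomposition of K into homogeneous parts, all odd
   parts being zero.  As K is even, K-scalars never produce Koszul signs. *)
Record even_grading (K : comNzRingType) := EvenGrading {
  gr :> int -> K -> Prop;
  gr0 : forall j, gr j 0;
  grB : forall j x y, gr j x -> gr j y -> gr j (x - y);
  gr1 : gr 0 1;
  grM : forall i j x y, gr i x -> gr j y -> gr (i + j) (x * y);
  gr_even : forall j x, odd `|j|%N -> gr j x -> x = 0;
  gr_span : forall x, exists2 s : seq K,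
    (forall y, y \in s -> exists j, gr j y) & x = \sum_(y <- s) y;
  gr_direct : forall (s : seq int) (F : int -> K), uniq s ->
    (forall j, gr j (F j)) -> \sum_(j <- s) F j = 0 ->
    forall j, j \in s -> F j = 0 }.

(* The free graded K-module V with homogeneous basis (e_b), e_b of degree
   bdeg b; the basis may be infinite. *)
Record free_graded := FreeGraded {
  basis : choiceType;
  bdeg : basis -> int }.

Section LieSeries.
Variables (K : comNzRingType) (G : even_grading K) (V : free_graded).

(* W := \Sigma V^* is topologically free on the dual basis x_b of
   (\Sigma e_b), and |x_b| = 1 - |e_b|.  Hence W^{\hat\otimes n} is the graded
   product of the K x_{b1}...x_{bn}, and an element of \hat T W is recorded
   by its coefficients on the words in the basis.  The elements of \hat T W are
   the series satisfying [graded] below. *)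
Definition word := seq (basis V).
Definition series := word -> K^o.

Definition wdeg (w : word) : int := \sum_(b <- w) (1 - bdeg b).

Definition homog (p : int) (f : series) := forall w, G (p - wdeg w) (f w).

Definition graded (f : series) := exists2 s : seq series,
  (forall g, g \in s -> exists p, homog p g) & f = \sum_(g <- s) g.

(* fg - (-1)^{|f||g|} gf: since K is even, the parity of a homogeneous
   term k.u is that of the word u, so that the sign can be read off on words. *)
Definition bracket (f g : series) : series := fun w =>
  \sum_(k < (size w).+1)
    (f (take k w) * g (drop k w) -
     (-1) ^+ absz (wdeg (take k w) * wdeg (drop k w)) *
       (g (take k w) * f (drop k w))).

Inductive lie_tree := Leaf of basis V | Node of lie_tree & lie_tree.

HB.instance Definition _ := gen_eqMixin lie_tree.
HB.instance Definition _ := gen_choiceMixin lie_tree.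

Fixpoint lie_monomial (t : lie_tree) : series :=
  match t with
  | Leaf b => fun w => (w == [:: b])%:R
  | Node t1 t2 => bracket (lie_monomial t1) (lie_monomial t2)
  end.

(* Convergence is coefficientwise, K being discrete. *)
Definition lie_series (f : series) := exists c : lie_tree -> K, forall w,
  exists S : seq lie_tree, [/\ uniq S,
    forall t, t \notin S -> c t * lie_monomial t w = 0 &
    f w = \sum_(t <- S) c t * lie_monomial t w].

Definition lie_pred : {pred series} := fun f => `[< lie_series f /\ graded f >].

Lemma sum_uniq_ext (S S' : seq lie_tree) (F : lie_tree -> K) :
  uniq S -> uniq S' -> {subset S <= S'} ->
  (forall t, t \notin S -> F t = 0) ->
  \sum_(t <- S) F t = \sum_(t <- S') F t.
Proof.
move=> uS uS' sub F0.
rewrite [RHS](bigID (mem S)) /= [X in _ + X]big1 ?addr0; last by move=> t /F0.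
rewrite -[RHS]big_filter; apply/perm_big/uniq_perm => //; first exact: filter_uniq.
move=> t; rewrite mem_filter; case: (boolP (t \in S)) => //= tS.
by rewrite sub.
Qed.

Lemma lie_seriesB f g : lie_series f -> lie_series g -> lie_series (f - g).
Proof.
move=> [c hc] [d hd]; exists (fun t => c t - d t) => w.
have [S [uS S0 ->]] : exists S : seq lie_tree, [/\ uniq S,
  forall t, t \notin S -> c t * lie_monomial t w = 0 /\
                          d t * lie_monomial t w = 0 &
  (f - g) w = \sum_(t <- S) c t * lie_monomial t w -
              \sum_(t <- S) d t * lie_monomial t w].
  have [S1 [u1 z1 e1]] := hc w; have [S2 [u2 z2 e2]] := hd w.
  exists (undup (S1 ++ S2)); split; first exact: undup_uniq.
    by move=> t; rewrite mem_undup mem_cat negb_or => /andP[/z1 ? /z2].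
  rewrite (_ : (f - g) w = f w - g w) // e1 e2.
  congr (_ - _); apply: sum_uniq_ext => //; first exact: undup_uniq.
  - by move=> t ht; rewrite mem_undup mem_cat ht.
  - exact: undup_uniq.
  - by move=> t ht; rewrite mem_undup mem_cat ht orbT.
exists S; split => //.
  by move=> t /S0 [h1 h2]; rewrite mulrBl h1 h2 subrr.
by rewrite -sumrB; apply: eq_bigr => t _; rewrite mulrBl.
Qed.

Lemma lie_seriesZ (k : K) f : lie_series f -> lie_series (k *: f).
Proof.
move=> [c hc]; exists (fun t => k * c t) => w; have [S [uS S0 e]] := hc w.
exists S; split => // [t /S0 h|]; first by rewrite -mulrA h mulr0.
rewrite (_ : (k *: f) w = k * f w) // e big_distrr /=.
by apply: eq_bigr => t _; rewrite mulrA.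
Qed.

Lemma lie_series0 : lie_series 0.
Proof.
exists (fun _ => 0) => w; exists [::]; split => // [t _|].
  by rewrite mul0r.
by rewrite big_nil.
Qed.

Lemma grN j x : G j x -> G j (- x).
Proof. by move=> h; rewrite -sub0r; apply: grB => //; apply: gr0. Qed.

Lemma grD j x y : G j x -> G j y -> G j (x + y).
Proof. by move=> hx hy; rewrite -[y]opprK; apply: grB => //; apply: grN. Qed.

Lemma gr_sign j x n : G j x -> G j ((-1) ^+ n * x).
Proof.
by move=> h; rewrite -signr_odd; case: (odd n); rewrite ?mul1r ?mulN1r //;
  apply: grN.
Qed.

Lemma homogN p f : homog p f -> homog p (- f).
Proof. by move=> h w; apply: grN; apply: h. Qed.

Lemma gradedB f g : graded f -> graded g -> graded (f - g).
Proof.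
move=> [s hs ->] [t ht ->]; exists (s ++ [seq - h | h <- t]).
  move=> h; rewrite mem_cat => /orP[/hs //|/mapP[h' /ht [p hp] ->]].
  by exists p; apply: homogN.
by rewrite big_cat /= big_map sumrN.
Qed.

Lemma gradedZ (k : K) f : graded f -> graded (k *: f).
Proof.
move=> [s hs ->]; have [t ht ->] := gr_span G k.
exists [seq y *: g | y <- t, g <- s].
  move=> h /allpairsP [[y g] /= [/ht [j yj] /hs [p gp] ->]].
  exists (j + p) => w; rewrite -addrA.
  by rewrite (_ : (y *: g) w = y * g w) //; apply: grM.
rewrite big_allpairs_dep /= scaler_suml; apply: eq_bigr => y _.
by rewrite scaler_sumr.
Qed.

Lemma graded0 : graded 0.
Proof. by exists [::]; rewrite ?big_nil. Qed.

Lemma lie_pred_submod : submod_closed lie_pred.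
Proof.
split; first by apply/asboolP; split; [exact: lie_series0|exact: graded0].
move=> k f g /asboolP[lf gf] /asboolP[lg gg]; apply/asboolP.
rewrite -[g]opprK -[- g]scaleN1r; split.
  by apply: lie_seriesB; apply: lie_seriesZ.
by apply: gradedB; apply: gradedZ.
Qed.

HB.instance Definition _ :=
  GRing.isSubmodClosed.Build K series lie_pred lie_pred_submod.

(* \hat L W *)
Record Lhat := MkLhat { lhat_val : series; _ : lhat_val \in lie_pred }.
HB.instance Definition _ := [isSub for lhat_val].
HB.instance Definition _ := [Choice of Lhat by <:].
HB.instance Definition _ := [SubChoice_isSubLmodule of Lhat by <:].

Lemma series_sumE (I : Type) (s : seq I) (F : I -> series) w :
  (\sum_(i <- s) F i) w = \sum_(i <- s) F i w.
Proof. by rewrite fct_sumE. Qed.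

Lemma bracket_suml (I : Type) (s : seq I) (F : I -> series) (g : series) :
  bracket (\sum_(i <- s) F i) g = \sum_(i <- s) bracket (F i) g.
Proof.
apply/funext => w; rewrite series_sumE [LHS]/bracket [RHS]exchange_big /=.
apply: eq_bigr => k _; rewrite !series_sumE.
by rewrite [RHS]sumrB -!(mulr_sumr, mulr_suml).
Qed.

Lemma bracket_sumr (I : Type) (s : seq I) (F : I -> series) (g : series) :
  bracket g (\sum_(i <- s) F i) = \sum_(i <- s) bracket g (F i).
Proof.
apply/funext => w; rewrite series_sumE [LHS]/bracket [RHS]exchange_big /=.
apply: eq_bigr => k _; rewrite !series_sumE.
by rewrite [RHS]sumrB -!(mulr_sumr, mulr_suml).
Qed.

Lemma bracketZl (k : K) (f g : series) : bracket (k *: f) g = k *: bracket f g.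
Proof.
apply/funext => w; rewrite (_ : (k *: bracket f g) w = k * bracket f g w) //.
rewrite /bracket mulr_sumr; apply: eq_bigr => i _.
rewrite !(_ : forall u, (k *: f) u = k * f u) // mulrBr.
congr (_ - _); first by rewrite mulrA.
by rewrite [RHS]mulrCA; congr (_ * _); rewrite mulrCA.
Qed.

Lemma bracketZr (k : K) (f g : series) : bracket f (k *: g) = k *: bracket f g.
Proof.
apply/funext => w; rewrite (_ : (k *: bracket f g) w = k * bracket f g w) //.
rewrite /bracket mulr_sumr; apply: eq_bigr => i _.
rewrite !(_ : forall u, (k *: g) u = k * g u) // mulrBr.
congr (_ - _); first by rewrite mulrCA.
by rewrite [RHS]mulrCA; congr (_ * _); rewrite mulrA.
Qed.

Lemma bracket_loc (f f' g g' : series) w :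
  (forall k, f (take k w) = f' (take k w) /\ f (drop k w) = f' (drop k w)) ->
  (forall k, g (take k w) = g' (take k w) /\ g (drop k w) = g' (drop k w)) ->
  bracket f g w = bracket f' g' w.
Proof.
by move=> hf hg; apply: eq_bigr => k _; rewrite !(hf k).1 !(hf k).2 !(hg k).1 !(hg k).2.
Qed.

Lemma bracket_homog p q f g :
  homog p f -> homog q g -> homog (p + q) (bracket f g).
Proof.
move=> hf hg w; rewrite /bracket.
apply: (big_ind (G (p + q - wdeg w))); [exact: gr0|exact: grD|move=> k _].
have e : wdeg w = wdeg (take k w) + wdeg (drop k w).
  by rewrite -{1}(cat_take_drop k w) /wdeg big_cat.
apply: grB; [|apply: gr_sign]; rewrite e.
  by rewrite opprD addrACA; apply: grM.
by rewrite [p + q]addrC opprD addrACA; apply: grM.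
Qed.

Lemma graded_bracket f g : graded f -> graded g -> graded (bracket f g).
Proof.
move=> [s hs ->] [t ht ->]; exists [seq bracket a b | a <- s, b <- t].
  move=> h /allpairsP [[a b] /= [/hs [p ap] /ht [q bq] ->]].
  by exists (p + q); apply: bracket_homog.
rewrite big_allpairs_dep /= bracket_suml; apply: eq_bigr => a _.
by rewrite bracket_sumr.
Qed.

Lemma lie_support f (c : lie_tree -> K) (ws : seq word) :
  (forall w, exists S : seq lie_tree, [/\ uniq S,
    forall t, t \notin S -> c t * lie_monomial t w = 0 &
    f w = \sum_(t <- S) c t * lie_monomial t w]) ->
  exists S : seq lie_tree, [/\ uniq S,
    forall w t, w \in ws -> t \notin S -> c t * lie_monomial t w = 0 &
    forall w, w \in ws -> f w = (\sum_(t <- S) c t *: lie_monomial t) w].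
Proof.
move=> h; elim: ws => [|w ws [S [uS S0 Sf]]]; first by exists [::].
have [S1 [u1 z1 e1]] := h w.
have sub1 : {subset S1 <= undup (S1 ++ S)}.
  by move=> t ht; rewrite mem_undup mem_cat ht.
have sub2 : {subset S <= undup (S1 ++ S)}.
  by move=> t ht; rewrite mem_undup mem_cat ht orbT.
exists (undup (S1 ++ S)); split; first exact: undup_uniq.
- move=> v t; rewrite inE mem_undup mem_cat negb_or => hv /andP[h1 h2].
  by case/orP: hv => [/eqP ->|hv]; [exact: z1|exact: S0].
- move=> v; rewrite inE => hv; rewrite series_sumE /=; case/orP: hv => [/eqP ->|hv].
    by rewrite e1; apply: sum_uniq_ext => //; exact: undup_uniq.
  rewrite Sf // series_sumE; apply: sum_uniq_ext => //; first exact: undup_uniq.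
  by move=> t; exact: S0.
Qed.

Lemma lie_series_bracket f g :
  lie_series f -> lie_series g -> lie_series (bracket f g).
Proof.
move=> [c hc] [d hd].
exists (fun t => if t is Node t1 t2 then c t1 * d t2 else 0) => w.
pose ws := [seq take k w | k <- iota 0 (size w).+1] ++
           [seq drop k w | k <- iota 0 (size w).+1].
have wsP k : take k w \in ws /\ drop k w \in ws.
  rewrite !mem_cat; case: (leqP k (size w)) => hk.
    split; apply/orP; [left|right]; apply/mapP; exists k => //;
    by rewrite mem_iota.
  split; apply/orP; [left|right]; apply/mapP; exists (size w);
  by rewrite ?mem_iota ?add0n ?ltnSn // ?take_oversize ?drop_oversize // ltnW.
have [S [uS S0 Sf]] := lie_support ws hc.
have [T [uT T0 Tg]] := lie_support ws hd.
have bE s t : c s * d t * bracket (lie_monomial s) (lie_monomial t) w =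
    bracket (c s *: lie_monomial s) (d t *: lie_monomial t) w.
  by rewrite bracketZl bracketZr scalerA.
exists [seq Node s t | s <- S, t <- T]; split.
- by apply: allpairs_uniq => // [[? ?] [? ?]] _ _ [-> ->].
- case=> [b _|s t hst /=]; first by rewrite mul0r.
  rewrite bE.
  have [sS|sS] := boolP (s \in S).
    have tT : t \notin T.
      by apply: contraNN hst => tT; apply: (allpairs_f Node).
    rewrite (@bracket_loc _ (c s *: lie_monomial s) _ 0).
    + by rewrite -(scale0r 0) bracketZr scale0r.
    + by [].
    + by move=> k; split; apply: (T0 _ t) => //; apply wsP.
  rewrite (@bracket_loc _ 0 _ (d t *: lie_monomial t)).
  + by rewrite -(scale0r 0) bracketZl scale0r.
  + by move=> k; split; apply: (S0 _ s) => //; apply wsP.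
  + by [].
- rewrite big_allpairs_dep /=.
  rewrite (@bracket_loc _ (\sum_(t <- S) c t *: lie_monomial t) _
                          (\sum_(t <- T) d t *: lie_monomial t)).
  + rewrite bracket_suml series_sumE; apply: eq_bigr => s _.
    by rewrite bracket_sumr series_sumE; apply: eq_bigr => t _; rewrite bE.
  + by move=> k; split; apply: Sf; apply wsP.
  + by move=> k; split; apply: Tg; apply wsP.
Qed.

Lemma bracket_subproof (a b : Lhat) : bracket (val a) (val b) \in lie_pred.
Proof.
case: a b => [f /= /asboolP[lf gf]] [g /= /asboolP[lg gg]]; apply/asboolP.
by split; [exact: lie_series_bracket|exact: graded_bracket].
Qed.

Definition lbracket (a b : Lhat) : Lhat := MkLhat (bracket_subproof a b).

End LieSeries.

Section Endomorphisms.
Variables (K : comNzRingType) (G : even_grading K) (V : free_graded).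
Local Notation L := (Lhat G V).
Implicit Types (f g : L -> L) (a b : L).

(* \hat L W carries the topology of the inverse limit of the free modules of
   finite rank spanned by finite sets of words. *)
Definition continuous_map f := forall w : word V, exists S : seq (word V),
  forall a, (forall u, u \in S -> val a u = 0) -> val (f a) w = 0.

Definition has_degree (d : int) f :=
  forall p a, homog G p (val a) -> homog G (p + d) (val (f a)).

Definition vector_field (d : int) f :=
  [/\ linear f, continuous_map f, has_degree d f &
      forall p a b, homog G p (val a) ->
        f (lbracket a b) =
          lbracket (f a) b + (-1) ^+ absz (d * p) *: lbracket a (f b)].

Definition elt_order (n : nat) a := forall w, size w != n -> val a w = 0.
Definition elt_order_ge (n : nat) a := forall w, (size w < n)%N -> val a w = 0.

(* There is no nonzero element of order 0 in \hat L W, so the truncated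
   predecessor is harmless. *)
Definition has_order (n : nat) f :=
  forall i a, elt_order i a -> elt_order (i + n).-1 (f a).
(* f lies in (n): for continuous linear f, this says that f is a convergent sum
   of endomorphisms of orders >= n. *)
Definition order_ge (n : nat) f :=
  forall i a, elt_order_ge i a -> elt_order_ge (i + n).-1 (f a).
Definition eq_mod (n : nat) f g := order_ge n (f - g).

Definition lie_hom f :=
  [/\ linear f, continuous_map f, has_degree 0 f &
      forall a b, f (lbracket a b) = lbracket (f a) (f b)].

(* psi is the inverse of phi in Aut(\hat L W) *)
Definition diffeo (phi psi : L -> L) :=
  [/\ lie_hom phi, lie_hom psi, cancel phi psi & cancel psi phi].

(* phi \o f \o phi^-1 = g mod (n) for some diffeomorphism phi of degree zero of
   the form id + phi_k + phi_{k+1} + ..., i.e. phi = id mod (k). *)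
Definition conj_equiv (k n : nat) f g := exists phi psi : L -> L,
  [/\ diffeo phi psi, eq_mod k phi id & eq_mod n (phi \o f \o psi) g].

Lemma elt_order_geB n a b :
  elt_order_ge n a -> elt_order_ge n b -> elt_order_ge n (a - b).
Proof.
move=> ha hb w hw; have -> : val (a - b) w = val a w - val b w by [].
by rewrite ha // hb // subrr.
Qed.

Lemma elt_order_geD n a b :
  elt_order_ge n a -> elt_order_ge n b -> elt_order_ge n (a + b).
Proof.
move=> ha hb w hw; have -> : val (a + b) w = val a w + val b w by [].
by rewrite ha // hb // addr0.
Qed.

Lemma elt_order_geW n m a : (m <= n)%N -> elt_order_ge n a -> elt_order_ge m a.
Proof. by move=> le h w hw; apply: h; apply: leq_trans le. Qed.

Lemma elt_order_ge0 n : elt_order_ge n 0.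
Proof. by move=> w _; rewrite raddf0. Qed.

Lemma eq_mod_id_order phi : eq_mod 2 phi id -> order_ge 1 phi.
Proof.
move=> h i a ha; rewrite addn1 /= -[phi a](subrK a); apply: elt_order_geD => //.
by apply: elt_order_geW (h i a ha); rewrite addn2.
Qed.

Lemma inverse_order phi psi : cancel psi phi -> eq_mod 2 phi id -> order_ge 1 psi.
Proof.
move=> hK h i a ha; rewrite addn1 /=.
suff: forall j, (j <= i)%N -> elt_order_ge j (psi a) by apply.
elim=> [|j IH] hj; first by [].
have e : psi a = a - (phi - id) (psi a).
  by rewrite (_ : (phi - id) (psi a) = phi (psi a) - psi a) // hK opprB addrC subrK.
rewrite e; apply: elt_order_geB; first exact: elt_order_geW ha.
by have := h j _ (IH (ltnW hj)); rewrite addn2.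
Qed.

Lemma eq_modW k l f g : (k <= l)%N -> eq_mod l f g -> eq_mod k f g.
Proof.
move=> kl h i a ha; apply: elt_order_geW (h i a ha).
by rewrite -!subn1 leq_sub2r // leq_add2l.
Qed.

Lemma order_ge_conj n phi f psi : order_ge 1 phi -> order_ge 1 psi ->
  order_ge n f -> order_ge n (phi \o f \o psi).
Proof.
move=> h1 h2 h i a ha /=; have := h2 _ _ ha; rewrite addn1 => /h/h1.
by rewrite addn1.
Qed.

Lemma conj_equiv_refl k n f : conj_equiv k n f f.
Proof.
have hid : lie_hom (id : L -> L).
  split=> //; first by move=> w; exists [:: w] => a; apply; rewrite inE.
  by move=> p a ha; rewrite addr0.
have h0 m : order_ge m (0 : L -> L) by move=> i a _; apply: elt_order_ge0.
by exists id, id; split=> //; rewrite /eq_mod subrr.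
Qed.

Lemma linear_subr (phi : L -> L) : linear phi -> {morph phi : a b / a - b}.
Proof.
by move=> h a b; rewrite -scaleN1r addrC h addrC scaleN1r.
Qed.

Lemma conj_equiv_sym k n f g : (2 <= k)%N ->
  conj_equiv k n f g -> conj_equiv k n g f.
Proof.
move=> k2 [phi [psi [[hphi hpsi K1 K2] e1 e2]]].
have o1 := eq_mod_id_order (eq_modW k2 e1).
have o2 := inverse_order K2 (eq_modW k2 e1).
have l2 : linear psi by case: hpsi.
exists psi, phi; split; first by split.
  move=> i a ha.
  rewrite (_ : (psi - id) a = - ((phi - id) (psi a))); last first.
    by rewrite !fctE K2 opprB.
  rewrite -sub0r; apply: elt_order_geB; first exact: elt_order_ge0.
  by apply: e1; have := o2 _ _ ha; rewrite addn1.
move=> i a ha.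
rewrite (_ : _ a = - ((psi \o (phi \o f \o psi - g) \o phi) a)); last first.
  by rewrite !fctE /= linear_subr // !K1 opprB.
rewrite -sub0r; apply: elt_order_geB; first exact: elt_order_ge0.
by apply: (order_ge_conj o2 o1 e2).
Qed.

Lemma conj_equiv_trans k n f g h : (2 <= k)%N ->
  conj_equiv k n f g -> conj_equiv k n g h -> conj_equiv k n f h.
Proof.
move=> k2 [phi [psi [[hphi hpsi K1 K2] e1 e2]]].
move=> [phi' [psi' [[hphi' hpsi' K1' K2'] e1' e2']]].
have comp u v : lie_hom u -> lie_hom v -> lie_hom (u \o v).
  move=> [l1 c1 d1 b1] [l2 c2 d2 b2]; split.
  - by move=> c a b /=; rewrite l2 l1.
  - move=> w; have [S hS] := c1 w.
    have [T hT] : exists T : seq (word V), forall a,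
      (forall u, u \in T -> val a u = 0) -> forall u, u \in S -> val (v a) u = 0.
      elim: S {hS} => [|x S [T hT]]; first by exists [::].
      have [T' hT'] := c2 x; exists (T' ++ T) => a ha y; rewrite inE.
      case/orP => [/eqP ->|hy].
        by apply: hT' => z hz; apply: ha; rewrite mem_cat hz.
      by apply: hT => // z hz; apply: ha; rewrite mem_cat hz orbT.
    by exists T => a ha; apply: hS; apply: hT.
  - by move=> p a ha /=; have := d1 _ _ (d2 _ _ ha); rewrite addr0.
  - by move=> a b /=; rewrite b2 b1.
have o1 := eq_mod_id_order (eq_modW k2 e1).
have o1' := eq_mod_id_order (eq_modW k2 e1').
have o2' := inverse_order K2' (eq_modW k2 e1').
exists (phi' \o phi), (psi \o psi'); split.
- split; [exact: comp|exact: comp| |].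
    by move=> a /=; rewrite K1' K1.
  by move=> a /=; rewrite K2 K2'.
- move=> i a ha.
  rewrite (_ : _ a = (phi' - id) (phi a) + (phi - id) a); last first.
    by rewrite !fctE /= addrA subrK.
  apply: elt_order_geD; last exact: e1.
  by apply: e1'; have := o1 _ _ ha; rewrite addn1.
- move=> i a ha.
  rewrite (_ : _ a = (phi' \o (phi \o f \o psi - g) \o psi') a +
                     (phi' \o g \o psi' - h) a); last first.
    rewrite !fctE /= (@linear_subr phi'); last by case: hphi'.
    by rewrite addrA subrK.
  apply: elt_order_geD; last exact: e2'.
  exact: (order_ge_conj o1' o2' e2).
Qed.

(* [f, g] for f of degree d and g of degree e *)
Definition commutator (d e : int) f g : L -> L :=
  fun a => f (g a) - (-1) ^+ absz (d * e) *: g (f a).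

Record graded_comm_alg := CommAlg {
  m2_of :> L -> L;
  _ : vector_field 1 m2_of;
  _ : has_order 2 m2_of;
  _ : forall a, m2_of (m2_of a) = 0 }.

(* m = m_2 + ... + m_{n-1}, with m_i of order i *)
Definition C_components (n : nat) (m : L -> L) (m_ : nat -> L -> L) :=
  (forall i, (2 <= i < n)%N -> vector_field 1 (m_ i) /\ has_order i (m_ i)) /\
  m = \sum_(2 <= i < n) m_ i.

Definition minimal_C (n : nat) (m : L -> L) :=
  [/\ vector_field 1 m, exists m_, C_components n m m_ &
      order_ge n.+1 (m \o m)].

Definition quadratic_part (n : nat) (m m2 : L -> L) :=
  exists2 m_, C_components n m m_ & m_ 2%N = m2.

Definition is_extension (n : nat) (m mn : L -> L) :=
  [/\ vector_field 1 mn, has_order n mn & minimal_C n.+1 (m + mn)].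

Definition extendable (n : nat) (m : L -> L) := exists mn, is_extension n m mn.

Section ExtensionClasses.
Variables (n : nat) (n_ge3 : (3 <= n)%N) (m : L -> L).

Record extension := Extension {
  ext_val : L -> L;
  _ : `[< is_extension n m ext_val >] }.
HB.instance Definition _ := [isSub for ext_val].
HB.instance Definition _ := [Choice of extension by <:].

Definition ext_rel : rel extension := fun x y =>
  `[< conj_equiv n.-1 n.+1 (m + ext_val x) (m + ext_val y) >].

Lemma ext_rel_refl : reflexive ext_rel.
Proof. by move=> x; apply/asboolP/conj_equiv_refl. Qed.

Lemma ext_rel_sym : symmetric ext_rel.
Proof.
have n2 : (2 <= n.-1)%N by case: n n_ge3.
by move=> x y; apply/asboolP/asboolP; apply: conj_equiv_sym.
Qed.

Lemma ext_rel_trans : transitive ext_rel.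
Proof.
have n2 : (2 <= n.-1)%N by case: n n_ge3.
move=> y x z /asboolP h1 /asboolP h2; apply/asboolP.
exact: conj_equiv_trans h1 h2.
Qed.

Definition ext_equiv : equiv_rel extension :=
  EquivRel ext_rel ext_rel_refl ext_rel_sym ext_rel_trans.

Definition ext_classes := {eq_quot ext_equiv}.

Definition ext_class (x : extension) : ext_classes := \pi_ext_classes x.

End ExtensionClasses.

Section Harrison.
Variable A : graded_comm_alg.

(* [j] is the degree in \Sigma^{-1} Der, i.e. vector fields of degree j - 1 *)
Definition cochain_pred (i : nat) (j : int) : {pred L -> L} :=
  fun f => `[< vector_field (j - 1) f /\ has_order i f >].

Lemma vector_field0 d : vector_field d 0.
Proof.
have zE a : (0 : L -> L) a = 0 by [].
have b0l (f : series K V) : bracket 0 f = 0.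
  by have := bracketZl 0 0 f; rewrite !scale0r.
have b0r (f : series K V) : bracket f 0 = 0.
  by have := bracketZr 0 f 0; rewrite !scale0r.
split.
- by move=> k a b; rewrite !zE scaler0 addr0.
- by move=> w; exists [::].
- by move=> p a _ w; apply: gr0.
- move=> p a b _; rewrite !zE; apply: val_inj => /=.
  by rewrite b0l b0r scaler0 addr0.
Qed.

Lemma bracketBl (f g h : series K V) :
  bracket (f - g) h = bracket f h - bracket g h.
Proof.
have := bracket_suml [:: f; - g] id h.
rewrite !big_cons !big_nil !addr0 => ->.
by rewrite -scaleN1r bracketZl scaleN1r.
Qed.

Lemma bracketBr (f g h : series K V) :
  bracket h (f - g) = bracket h f - bracket h g.
Proof.
have := bracket_sumr [:: f; - g] id h.
rewrite !big_cons !big_nil !addr0 => ->.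
by rewrite -scaleN1r bracketZr scaleN1r.
Qed.

Lemma lbracketBl a b c : @lbracket K G V (a - b) c = lbracket a c - lbracket b c.
Proof. by apply: val_inj; apply: bracketBl. Qed.

Lemma lbracketBr a b c : @lbracket K G V c (a - b) = lbracket c a - lbracket c b.
Proof. by apply: val_inj; apply: bracketBr. Qed.

Lemma vector_fieldB d f g :
  vector_field d f -> vector_field d g -> vector_field d (f - g).
Proof.
move=> [l1 c1 d1 b1] [l2 c2 d2 b2]; split.
- move=> k a b; rewrite !fctE l1 l2 opprD addrACA; congr (_ + _).
  by rewrite scalerBr.
- move=> w; have [S hS] := c1 w; have [T hT] := c2 w; exists (S ++ T) => a ha.
  rewrite !fctE raddfB /= (_ : forall u v : series K V, (u - v) w = u w - v w) //.
  by rewrite hS ?hT ?subrr // => u hu; apply: ha; rewrite mem_cat hu ?orbT.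
- move=> p a ha w; rewrite !fctE raddfB /=.
  by apply: grB; [exact: d1|exact: d2].
- move=> p a b ha; rewrite !fctE (b1 p) // (b2 p) // lbracketBl lbracketBr.
  by rewrite scalerBr opprD addrACA.
Qed.

Lemma cochain_zmod i j : zmod_closed (cochain_pred i j).
Proof.
split.
  apply/asboolP; split; first exact: vector_field0.
  by move=> k a _ w _.
move=> f g /asboolP[vf of_] /asboolP[vg og]; apply/asboolP.
split; first exact: vector_fieldB.
move=> k a ha w hw; rewrite !fctE raddfB /=.
rewrite (_ : forall u v : series K V, (u - v) w = u w - v w) //.
by rewrite (of_ _ _ ha) ?(og _ _ ha) ?subrr.
Qed.

HB.instance Definition _ i j :=
  GRing.isZmodClosed.Build (L -> L) (cochain_pred i j) (cochain_zmod i j).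

Record cochain (i : nat) (j : int) := Cochain {
  cochain_val : L -> L;
  _ : cochain_val \in cochain_pred i j }.
HB.instance Definition _ i j := [isSub for @cochain_val i j].
HB.instance Definition _ i j := [Choice of cochain i j by <:].
HB.instance Definition _ i j := [SubChoice_isSubZmodule of cochain i j by <:].

Definition differential i j (xi : cochain i j) : L -> L :=
  commutator 1 (j - 1) A (cochain_val xi).

Lemma differential0 i j : differential (0 : cochain i j) = 0.
Proof.
have lA : linear A by case: A => ? [].
have A0 : A 0 = 0 by rewrite -[in LHS](subrr 0) linear_subr ?subrr.
apply/funext => a.
by rewrite /differential /commutator (_ : cochain_val 0 = 0) // A0 scaler0 subrr.
Qed.

Lemma differentialB i j (x y : cochain i j) :
  differential (x - y) = differential x - differential y.
Proof.
have lA : linear A by case: A => ? [].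
apply/funext => a; rewrite /differential /commutator.
have -> : cochain_val (x - y) = cochain_val x - cochain_val y by [].
by rewrite !fctE (@linear_subr A) // scalerBr !opprD [RHS]addrACA.
Qed.

Definition cocycle_pred i j : {pred cochain i j} :=
  fun xi => differential xi == 0.

Lemma cocycle_zmod i j : zmod_closed (@cocycle_pred i j).
Proof.
split; first by apply/eqP/differential0.
by move=> x y /eqP hx /eqP hy; apply/eqP; rewrite differentialB hx hy subrr.
Qed.

HB.instance Definition _ i j :=
  GRing.isZmodClosed.Build (cochain i j) (@cocycle_pred i j) (cocycle_zmod i j).

Record cocycle (i : nat) (j : int) := Cocycle {
  cocycle_val : cochain i j;
  _ : cocycle_val \in @cocycle_pred i j }.
HB.instance Definition _ i j := [isSub for @cocycle_val i j].
HB.instance Definition _ i j := [Choice of cocycle i j by <:].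
HB.instance Definition _ i j := [SubChoice_isSubZmodule of cocycle i j by <:].

Definition coboundary i j (xi : cocycle i j) :=
  exists i', i = i'.+1 /\ exists eta : cochain i' (j - 1),
    cochain_val (cocycle_val xi) = differential eta.

Definition coboundary_pred i j : {pred cocycle i j} :=
  fun xi => (xi == 0) || `[< coboundary xi >].

Lemma coboundary_zmod i j : zmod_closed (@coboundary_pred i j).
Proof.
split; first by rewrite unfold_in eqxx.
have hB (x y : cocycle i j) : coboundary x -> coboundary y -> coboundary (x - y).
  move=> [i' [e [eta h]]] [i'' [e' [eta' h']]].
  have ii : i' = i'' by move: e; rewrite e' => -[].
  subst i''; exists i'; split=> //; exists (eta - eta').
  by rewrite differentialB -h -h'.
have h0 (x : cocycle i j) : coboundary x -> coboundary (0 : cocycle i j).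
  by move=> hx; have := hB _ _ hx hx; rewrite subrr.
move=> x y /orP[/eqP ->|/asboolP hx] /orP[/eqP ->|/asboolP hy]; apply/orP.
- by left; rewrite subrr.
- by right; apply/asboolP; apply: hB => //; apply: h0 hy.
- by right; rewrite subr0; apply/asboolP.
- by right; apply/asboolP; apply: hB.
Qed.

HB.instance Definition _ i j :=
  GRing.isZmodClosed.Build (cocycle i j) (@coboundary_pred i j)
    (coboundary_zmod i j).

(* The quotient additive group (despite its name, [ideal_quot] only needs an
   additive subgroup). *)
Definition Harr (i : nat) (j : int) := {ideal_quot (@coboundary_pred i j)}.
HB.instance Definition _ i j := GRing.Zmodule.on (Harr i j).

Definition Harr_class i j (xi : cocycle i j) : Harr i j := \pi_(Harr i j) xi.

End Harrison.

End Endomorphisms.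

Definition is_action (H : zmodType) (E : Type) (act : H -> E -> E) :=
  (forall e, act 0 e = e) /\ (forall x y e, act (x + y) e = act x (act y e)).

Definition free_action (H : zmodType) (E : Type) (act : H -> E -> E) :=
  forall x e, act x e = e -> x = 0.

(* E is a single orbit, in particular nonempty *)
Definition transitive_action (H : zmodType) (E : Type) (act : H -> E -> E) :=
  exists e0, forall e, exists x, act x e0 = e.

(* Main.v *)
Require Import Defs.
From HB Require Import structures.
From mathcomp Require Import all_boot all_order all_algebra.
From mathcomp Require Import boolp functions.
From mathcomp Require Import zify ring.
Import GRing.Theory.
Local Open Scope ring_scope.
Set Implicit Arguments.
Unset Strict Implicit.
Unset Printing Implicit Defensive.

(* Adding a vector field xi of order n and degree one to an extension m_n changes
   (m + m_n)^2 modulo (n+2) by exactly [m_2, xi], so that the extensions of m form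
   a torsor under the cocycles of bidegree (n, 2).  If phi = id + phi_{n-1} + ...,
   then phi (m + m_n) phi^{-1} = m + m_n - [m_2, phi_{n-1}] modulo (n+1), and
   phi_{n-1} is a vector field; hence equivalent extensions differ by a coboundary.
   Conversely the coboundary of eta is realised by phi = exp(- eta), which
   converges because eta raises the order, and needs only the rational scalars
   1/k!, which are of degree zero.  Hence two extensions are equivalent exactly
   when their difference is a coboundary. *)

(** * Homogeneous components of scalars *)

Section GradedComponents.
Variables (K : comNzRingType) (G : even_grading K).

Definition graded_parts (x : K) (F : int -> K) :=
  (forall j, G j (F j)) /\
  exists s : seq int, [/\ uniq s, forall j, j \notin s -> F j = 0 &
                          x = \sum_(j <- s) F j].

Lemma gr_sum (I : Type) j (s : seq I) (P : pred I) (F : I -> K) :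
  (forall i, P i -> G j (F i)) -> G j (\sum_(i <- s | P i) F i).
Proof. by move=> h; apply: big_ind => //; [exact: gr0|exact: grD]. Qed.

(** [gr_span] writes [x] as a sum of homogeneous elements without recording their degrees: choose a
    degree for each and collect the terms of equal degree. *)
Lemma graded_parts_ex x : exists F, graded_parts x F.
Proof.
have [s hs xE] := gr_span G x.
have /choice[d hd] : forall y, exists j, y \in s -> G j y.
  move=> y; case: (boolP (y \in s)) => [/hs [j hj]|_]; last by exists 0.
  by exists j.
exists (fun j => \sum_(y <- s | d y == j) y); split.
  move=> j; rewrite big_seq_cond; apply: gr_sum => y /andP[ys /eqP <-].
  exact: hd.
exists (undup (map d s)); split; first exact: undup_uniq.
  move=> j; rewrite mem_undup => hj; rewrite big_seq_cond big1 // => y.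
  by case/andP=> ys /eqP dj; case/negP: hj; rewrite -dj map_f.
rewrite xE (exchange_big_dep xpredT) //= big_seq [RHS]big_seq.
apply: eq_bigr => y ys; rewrite -big_filter.
rewrite (_ : [seq j <- _ | _] = [:: d y]) ?big_seq1 //.
have -> : [seq j <- undup (map d s) | d y == j] =
          [seq j <- undup (map d s) | pred1 (d y) j].
  by apply: eq_filter => j; rewrite /= eq_sym.
by rewrite filter_pred1_uniq ?undup_uniq // mem_undup map_f.
Qed.

Definition gr_part (j : int) (x : K) : K := sval (cid (graded_parts_ex x)) j.

Lemma gr_partP x : graded_parts x (gr_part^~ x).
Proof. exact: svalP (cid (graded_parts_ex x)). Qed.

Lemma gr_part_gr j x : G j (gr_part j x).
Proof. by have [+ _] := gr_partP x; apply. Qed.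

Lemma sum_uniq_sub (I : eqType) (s s' : seq I) (F : I -> K) :
  uniq s -> uniq s' -> {subset s <= s'} ->
  (forall t, t \notin s -> F t = 0) ->
  \sum_(t <- s) F t = \sum_(t <- s') F t.
Proof.
move=> us us' sub F0.
rewrite [RHS](bigID (mem s)) /= [X in _ + X]big1 ?addr0; last by move=> t /F0.
rewrite -[RHS]big_filter; apply/perm_big/uniq_perm => //.
  exact: filter_uniq.
move=> t; rewrite mem_filter; case: (boolP (t \in s)) => //= ts.
by rewrite sub.
Qed.

Lemma gr_partE x F j : graded_parts x F -> gr_part j x = F j.
Proof.
move=> [gF [s [us s0 xs]]]; have [gP [t [ut t0 xt]]] := gr_partP x.
apply/eqP; rewrite -subr_eq0; apply/eqP.
(* [j] joins both supports because [gr_direct] gives vanishing only at listed degrees. *)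
pose u := undup (j :: s ++ t).
have uu : uniq u by exact: undup_uniq.
apply: (gr_direct (e := G) (s := u) (F := fun j => gr_part j x - F j)) => //.
- by move=> i; apply: grB.
- rewrite sumrB -(sum_uniq_sub ut uu) // -?(sum_uniq_sub us uu) // -?xs -?xt ?subrr //.
    by move=> i hi; rewrite mem_undup inE mem_cat hi orbT.
  by move=> i hi; rewrite mem_undup inE mem_cat hi !orbT.
- by rewrite mem_undup mem_head.
Qed.

Lemma graded_partsD x y F F' : graded_parts x F -> graded_parts y F' ->
  graded_parts (x + y) (F \+ F').
Proof.
move=> [gF [s [us s0 ->]]] [gF' [t [ut t0 ->]]]; split.
  by move=> j; apply: grD.
pose u := undup (s ++ t); have uu : uniq u by exact: undup_uniq.
have ss : {subset s <= u} by move=> i hi; rewrite mem_undup mem_cat hi.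
have st : {subset t <= u} by move=> i hi; rewrite mem_undup mem_cat hi orbT.
exists u; split=> //.
  move=> j hj; rewrite /= s0 ?t0 ?addr0 //.
    by apply: contra hj; exact: st.
  by apply: contra hj; exact: ss.
by rewrite big_split /= (sum_uniq_sub us uu) // (sum_uniq_sub ut uu).
Qed.

Lemma gr_partD j x y : gr_part j (x + y) = gr_part j x + gr_part j y.
Proof. exact: (gr_partE j (graded_partsD (gr_partP x) (gr_partP y))). Qed.

Lemma gr_part_homog j i x : G i x -> gr_part j x = if j == i then x else 0.
Proof.
move=> hx.
suff h : graded_parts x (fun j => if j == i then x else 0).
  by rewrite (gr_partE j h).
split; first by move=> k; case: eqP => [->|_] //; exact: gr0.
exists [:: i]; split=> //; last by rewrite big_seq1 eqxx.
by move=> k; rewrite inE => /negbTE ->.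
Qed.

Lemma gr_part0 j : gr_part j 0 = 0.
Proof. by rewrite (gr_part_homog j (gr0 G 0)) if_same. Qed.

Lemma gr_part_sum (I : Type) j (s : seq I) (F : I -> K) :
  gr_part j (\sum_(i <- s) F i) = \sum_(i <- s) gr_part j (F i).
Proof.
elim: s => [|i s IH]; first by rewrite !big_nil gr_part0.
by rewrite !big_cons gr_partD IH.
Qed.

Lemma gr_partMr j e x y : G e y -> gr_part (j + e) (x * y) = gr_part j x * y.
Proof.
move=> hy; have [gP [t [ut t0 xt]]] := gr_partP x.
rewrite (@gr_partE _ (fun k => gr_part (k - e) x * y)) ?addrK //; split.
  by move=> k; rewrite -{1}(subrK e k); apply: grM.
exists (map (+%R^~ e) t); split.
- by rewrite map_inj_uniq //; apply: addIr.
- move=> k hk; rewrite t0 ?mul0r //; apply: contra hk => hk.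
  by apply/mapP; exists (k - e); rewrite ?subrK.
- rewrite {1}xt mulr_suml big_map; apply: eq_bigr => i _.
  by rewrite addrK.
Qed.

Lemma gr_nat k : G 0 k%:R.
Proof.
elim: k => [|k IH]; first exact: gr0.
by rewrite -[k.+1]addn1 natrD; apply: grD => //; exact: gr1.
Qed.

(** Taking degree-zero parts in [y * x = 1] shows that [gr_part 0 y] is also inverse to [x], hence
    equals [y]. This puts the scalars [1/k!] in degree zero. *)
Lemma gr0_inv x y : G 0 x -> x * y = 1 -> G 0 y.
Proof.
move=> hx xy.
suff -> : y = gr_part 0 y by exact: gr_part_gr.
have e : gr_part (0 + 0) (y * x) = gr_part 0 y * x by exact: gr_partMr.
rewrite addr0 [y * x]mulrC xy (gr_part_homog 0 (gr1 G)) eqxx in e.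
by rewrite -[LHS]mul1r e -mulrA xy mulr1.
Qed.

End GradedComponents.

(** * Homogeneous components of Lie series *)

Section LieElements.
Variables (K : comNzRingType) (G : even_grading K) (V : free_graded).
Local Notation L := (Lhat G V).
Implicit Types (a b : L).

Fixpoint tree_deg (t : lie_tree V) : int :=
  match t with
  | Leaf b => 1 - bdeg b
  | Node t1 t2 => tree_deg t1 + tree_deg t2
  end.

Fixpoint leaves (t : lie_tree V) : nat :=
  match t with Leaf _ => 1%N | Node t1 t2 => (leaves t1 + leaves t2)%N end.

Lemma leaves_gt0 t : (0 < leaves t)%N.
Proof. by elim: t => //= t1 h1 t2 h2; rewrite addn_gt0 h1. Qed.

Lemma bracket_eq0 (f g : series K V) w :
  (forall k, (k <= size w)%N -> f (take k w) * g (drop k w) = 0 /\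
             g (take k w) * f (drop k w) = 0) -> bracket f g w = 0.
Proof.
move=> h; rewrite /bracket big1 // => k _.
by have [-> ->] := h k (ltn_ord k); rewrite mulr0 subr0.
Qed.

Lemma lie_monomial_homog t : homog G (tree_deg t) (lie_monomial K t).
Proof.
elim: t => [b|t1 h1 t2 h2]; last exact: bracket_homog.
move=> w /=; case: eqP => [->|_]; last exact: gr0.
by rewrite /wdeg big_seq1 subrr; exact: gr1.
Qed.

Lemma lie_monomial_size t (w : word V) : size w != leaves t -> lie_monomial K t w = 0.
Proof.
elim: t w => [b|t1 h1 t2 h2] w hw /=.
  by case: eqP => // e; rewrite e in hw.
move: hw => /= hw; apply: bracket_eq0 => k hk.
have e1 := size_takel hk; have e2 := size_drop k w.
split.
- have [hl|hl] := eqVneq k (leaves t1); last by rewrite h1 ?mul0r // e1.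
  by rewrite (h2 (drop k w)) ?mulr0 // e2; lia.
- have [hl|hl] := eqVneq k (leaves t2); last by rewrite h2 ?mul0r // e1.
  by rewrite (h1 (drop k w)) ?mulr0 // e2; lia.
Qed.

(** Only trees with [size w] leaves contribute on [w], so the coefficients of [F N] can be kept for
    the trees with [N] leaves and dropped elsewhere. This is how series assembled order by order are
    seen to be Lie series. *)
Lemma lie_series_diag (F : nat -> series K V) :
  (forall N, lie_series (F N)) -> lie_series (fun w => F (size w) w).
Proof.
move=> h; have [c hc] := choice h.
exists (fun t => c (leaves t) t) => w.
have [S [uS S0 Sf]] := hc (size w) w.
have e t : c (leaves t) t * lie_monomial K t w = c (size w) t * lie_monomial K t w.
  have [<-|hs] := eqVneq (size w) (leaves t); first by [].
  by rewrite lie_monomial_size ?mulr0.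
exists S; split=> //; first by move=> t tS; rewrite e; apply: S0.
by rewrite Sf; apply: eq_bigr => t _; rewrite e.
Qed.

Definition degree_part (p : int) (f : series K V) : series K V :=
  fun w => gr_part G (p - wdeg w) (f w).

(** A Lie monomial is homogeneous, so passing to the degree [p] part only replaces the coefficient
    of each tree [t] by its part of degree [p - tree_deg t]. *)
Lemma lie_series_degree_part p (f : series K V) : lie_series f -> lie_series (degree_part p f).
Proof.
move=> [c hc]; exists (fun t => gr_part G (p - tree_deg t) (c t)) => w.
have [S [uS S0 Sf]] := hc w.
have e t : gr_part G (p - tree_deg t) (c t) * lie_monomial K t w =
           gr_part G (p - wdeg w) (c t * lie_monomial K t w).
  rewrite -(gr_partMr _ _ (lie_monomial_homog t w)); congr (gr_part _ _ _).
  by rewrite addrA subrK.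
exists S; split=> //; first by move=> t tS; rewrite e S0 // gr_part0.
by rewrite /degree_part Sf gr_part_sum; apply: eq_bigr => t _; rewrite e.
Qed.

Lemma degree_part_homog p (f : series K V) : homog G p (degree_part p f).
Proof. by move=> w; exact: gr_part_gr. Qed.

Lemma degree_partE p q (f : series K V) : homog G q f ->
  degree_part p f = if p == q then f else 0.
Proof.
move=> hf; apply/funext => w; rewrite /degree_part (gr_part_homog _ (hf w)).
by rewrite (inj_eq (addIr _)); case: eqP.
Qed.

Lemma homog_graded p (f : series K V) : homog G p f -> graded G f.
Proof.
by move=> hf; exists [:: f]; rewrite ?big_seq1 // => g; rewrite inE => /eqP ->; exists p.
Qed.

(** The homogeneous summands provided by [graded] need not be Lie series; the degree parts of [a]
    itself are, and the degrees of those summands suffice. *)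
Lemma Lhat_homog_sum a : exists2 s : seq L,
  (forall b, b \in s -> exists p, homog G p (val b)) & a = \sum_(b <- s) b.
Proof.
have /asboolP[la [s hs aE]] := valP a.
have /choice[d hd] : forall f, exists j, f \in s -> homog G j f.
  move=> f; case: (boolP (f \in s)) => [/hs [j hj]|_]; last by exists 0.
  by exists j.
have mem p : degree_part p (val a) \in @lie_pred K G V.
  apply/asboolP; split; first exact: lie_series_degree_part.
  exact: homog_graded (degree_part_homog _ _).
exists [seq MkLhat (mem p) | p <- undup (map d s)].
  by move=> b /mapP[p _ ->]; exists p; apply: degree_part_homog.
apply: val_inj; rewrite raddf_sum /= big_map.
apply/funext => w; rewrite series_sumE /=.
have e p : degree_part p (val a) w = \sum_(f <- s) degree_part p f w.
  by rewrite /degree_part aE series_sumE gr_part_sum.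
under eq_bigr do rewrite e.
rewrite aE exchange_big /= series_sumE big_seq [RHS]big_seq.
apply: eq_bigr => f fs.
under eq_bigr do rewrite (degree_partE _ (hd f fs)).
rewrite (bigD1_seq (d f)) ?undup_uniq ?mem_undup ?map_f //= eqxx big1 ?addr0 //.
by move=> p /negbTE ->.
Qed.

Lemma Lhat_homog_ind (P : L -> Prop) :
  (forall p a, homog G p (val a) -> P a) ->
  (forall a b, P a -> P b -> P (a + b)) -> forall a, P a.
Proof.
move=> hP hD a; have [s hs ->] := Lhat_homog_sum a.
elim: s hs => [|b s IH] hs.
  by rewrite big_nil; apply: (hP 0) => w; exact: gr0.
rewrite big_cons; apply: hD.
  by have [p hp] := hs b (mem_head _ _); apply: hP hp.
by apply: IH => c hc; apply: hs; rewrite inE hc orbT.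
Qed.

Lemma Lhat_order_ge1 a : elt_order_ge 1 a.
Proof.
move=> w; rewrite ltnS leqn0 => /nilP ->.
have /asboolP[[c hc] _] := valP a; have [S [_ _ ->]] := hc [::].
rewrite big1 // => t _; rewrite lie_monomial_size ?mulr0 //.
by rewrite eq_sym -lt0n leaves_gt0.
Qed.

Implicit Types (f g : L -> L).

Section LinearMaps.
Variables (f : L -> L) (lf : linear f).

Lemma linear_map0 : f 0 = 0.
Proof. by rewrite -[in LHS](subrr 0) linear_subr ?subrr. Qed.

Lemma linear_mapD a b : f (a + b) = f a + f b.
Proof. by have := lf 1 a b; rewrite !scale1r. Qed.

Lemma linear_mapN a : f (- a) = - f a.
Proof. by rewrite -sub0r linear_subr // linear_map0 sub0r. Qed.

Lemma linear_mapZ k a : f (k *: a) = k *: f a.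
Proof. by have := lf k a 0; rewrite linear_map0 !addr0. Qed.

Lemma linear_map_sum (I : Type) (s : seq I) (F : I -> L) :
  f (\sum_(i <- s) F i) = \sum_(i <- s) f (F i).
Proof.
elim: s => [|i s IH]; first by rewrite !big_nil linear_map0.
by rewrite !big_cons linear_mapD IH.
Qed.

End LinearMaps.

(** Glues a sequence of maps into one by letting the [N]-th map govern the words of length [N].
    Order projections, exponentials and leading parts are all built this way. *)
Definition diag_series (T : nat -> L -> L) (a : L) : series K V :=
  fun w => val (T (size w) a) w.

(* Junk value [0] when [diag_series T a] is not in [L]; see [val_diag_map]. *)
Definition diag_map (T : nat -> L -> L) (a : L) : L := insubd 0 (diag_series T a).

Section Diagonal.
Variables (T : nat -> L -> L).
Hypotheses (lT : forall N, linear (T N)) (dT : forall N, has_degree 0 (T N)).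

Lemma val_diag_map a : val (diag_map T a) = diag_series T a.
Proof.
rewrite val_insubd ifT //; apply/asboolP; split.
  apply: (@lie_series_diag (fun N => val (T N a))) => N.
  by have /asboolP[] := valP (T N a).
have [s hs ->] := Lhat_homog_sum a.
have -> : diag_series T (\sum_(b <- s) b) = \sum_(b <- s) diag_series T b.
  apply/funext => w; rewrite series_sumE /diag_series linear_map_sum // raddf_sum.
  by rewrite series_sumE.
rewrite big_seq; apply: big_ind; first exact: graded0.
  move=> u v hu hv; rewrite -[v]opprK; apply: gradedB => //.
  by rewrite -sub0r; apply: gradedB => //; apply: graded0.
move=> b /hs [p hp]; apply: (@homog_graded p) => w.
by have := dT (size w) hp w; rewrite addr0.
Qed.

Lemma diag_mapE a w : val (diag_map T a) w = val (T (size w) a) w.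
Proof. by rewrite val_diag_map. Qed.

Lemma diag_map_linear : linear (diag_map T).
Proof.
move=> k a b; apply: val_inj; apply/funext => w.
have -> : val (k *: diag_map T a + diag_map T b) w =
  k * val (diag_map T a) w + val (diag_map T b) w by [].
by rewrite !diag_mapE lT.
Qed.

Lemma diag_map_degree : has_degree 0 (diag_map T).
Proof. by move=> p a ha w; rewrite diag_mapE; apply: dT. Qed.

Lemma diag_map_continuous :
  (forall N, continuous_map (T N)) -> continuous_map (diag_map T).
Proof.
move=> cT w; have [S hS] := cT (size w) w; exists S => a ha.
by rewrite diag_mapE; apply: hS.
Qed.

End Diagonal.

Lemma continuous_comp f g : continuous_map f -> continuous_map g ->
  continuous_map (f \o g).
Proof.
move=> cf cg w; have [S hS] := cf w.
suff [T hT] : exists T : seq (word V), forall a,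
    (forall u, u \in T -> val a u = 0) -> forall u, u \in S -> val (g a) u = 0.
  by exists T => a ha; apply: hS; apply: hT.
elim: S {hS} => [|x S [T hT]]; first by exists [::].
have [T' hT'] := cg x; exists (T' ++ T) => a ha y; rewrite inE.
case/orP => [/eqP ->|hy].
  by apply: hT' => z hz; apply: ha; rewrite mem_cat hz.
by apply: hT => // z hz; apply: ha; rewrite mem_cat hz orbT.
Qed.

Lemma continuous_id : continuous_map (id : L -> L).
Proof. by move=> w; exists [:: w] => a; apply; rewrite inE. Qed.

Lemma continuous_0 : continuous_map (0 : L -> L).
Proof. by move=> w; exists [::]. Qed.

Lemma continuous_addZ k f g : continuous_map f -> continuous_map g ->
  continuous_map (k *: f + g).
Proof.
move=> cf cg w; have [S hS] := cf w; have [T hT] := cg w.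
exists (S ++ T) => a ha.
have -> : val ((k *: f + g) a) w = k * val (f a) w + val (g a) w by [].
by rewrite hS ?hT ?mulr0 ?addr0 // => u hu; apply: ha; rewrite mem_cat hu ?orbT.
Qed.

Definition order_part (i : nat) : L -> L :=
  diag_map (fun N => if N == i then id else 0).

Lemma linear_id_or_0 (b : bool) : linear (if b then id else 0 : L -> L).
Proof.
by case: b => // k x y; rewrite !(_ : forall z, (0 : L -> L) z = 0) // scaler0 addr0.
Qed.

Lemma degree_id_or_0 (b : bool) : has_degree 0 (if b then id else 0 : L -> L).
Proof.
case: b => p x hx; first by rewrite addr0.
by move=> w; exact: gr0.
Qed.

Lemma order_partE i a w : val (order_part i a) w = if size w == i then val a w else 0.
Proof.
rewrite diag_mapE; last by move=> N; exact: degree_id_or_0.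
  by case: eqP.
by move=> N; exact: linear_id_or_0.
Qed.

Lemma order_part_linear i : linear (order_part i).
Proof.
apply: diag_map_linear => N; [exact: linear_id_or_0|exact: degree_id_or_0].
Qed.

Lemma order_part_degree i : has_degree 0 (order_part i).
Proof.
apply: diag_map_degree => N; [exact: linear_id_or_0|exact: degree_id_or_0].
Qed.

Lemma order_part_continuous i : continuous_map (order_part i).
Proof.
apply: diag_map_continuous => N; [exact: linear_id_or_0|exact: degree_id_or_0|].
by case: eqP => _; [exact: continuous_id|exact: continuous_0].
Qed.

Lemma order_part_order i a : elt_order i (order_part i a).
Proof. by move=> w /negbTE hw; rewrite order_partE hw. Qed.

Lemma elt_order_ge_order i a : elt_order i a -> elt_order_ge i a.
Proof. by move=> h w hw; apply: h; rewrite ltn_eqF. Qed.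

Lemma LhatB a b w : val (a - b) w = val a w - val b w.
Proof. by []. Qed.

Lemma LhatD a b w : val (a + b) w = val a w + val b w.
Proof. by []. Qed.

Lemma Lhat_sum (I : Type) (s : seq I) (F : I -> L) w :
  val (\sum_(i <- s) F i) w = \sum_(i <- s) val (F i) w.
Proof. by rewrite raddf_sum series_sumE. Qed.

(** Subtracting from [a] its components of order below [N] leaves an element of order at least [N],
    to which the first hypothesis applies. *)
Lemma linear_eq0_order_parts f a w N : linear f ->
  (forall b, elt_order_ge N b -> val (f b) w = 0) ->
  (forall j, val (f (order_part j a)) w = 0) -> val (f a) w = 0.
Proof.
move=> lf hN hj.
pose b := \sum_(0 <= j < N) order_part j a.
have : val (f (a - b)) w = 0.
  apply: hN => u hu; rewrite LhatB Lhat_sum (bigD1_seq (size u)) ?iota_uniq //=.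
    rewrite order_partE eqxx big1 ?addr0 ?subrr // => i hi.
    by rewrite order_partE eq_sym (negbTE hi).
  by rewrite mem_index_iota.
rewrite linear_subr // LhatB linear_map_sum // Lhat_sum big1 ?subr0 //.
Qed.

Lemma has_order_order_ge n f : linear f -> continuous_map f ->
  has_order n f -> order_ge n f.
Proof.
move=> lf cf of_ i a ha w hw; have [S hS] := cf w.
(* The cutoff exceeds the length of every word in [S], so elements of at least this order vanish on
   [S] and, by continuity, do not affect the coefficient on [w]. *)
apply: (@linear_eq0_order_parts f a w (\max_(u <- S) (size u)).+1) => //.
  move=> b hb; apply: hS => u uS; apply: hb; rewrite ltnS.
  exact: leq_bigmax_seq.
move=> j; have [ij|ji] := leqP i j.
  apply: (of_ j); first exact: order_part_order.
  by apply: contraTneq hw => ->; rewrite -leqNgt; lia.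
have -> : order_part j a = 0.
  apply: val_inj; apply/funext => u; rewrite order_partE; case: eqP => // uj.
  by apply: ha; rewrite uj.
by rewrite linear_map0.
Qed.

(** The image of a component of order [j] lies in order exactly [j + n - 1] and in order at least
    [j + n]. This turns congruences between leading terms into equalities. *)
Lemma has_order_eq0 n f : linear f -> continuous_map f ->
  has_order n f -> order_ge n.+1 f -> f = 0.
Proof.
move=> lf cf of_ gf; apply/funext => a; apply: val_inj; apply/funext => w.
have [S hS] := cf w.
apply: (@linear_eq0_order_parts f a w (size w).+1) => //.
  move=> b hb; apply: (gf _ _ hb); lia.
move=> j.
have [hw|hw] := eqVneq (size w) (j + n).-1; last first.
  exact: (of_ _ _ (order_part_order (i := j) a)).
have [->|nz] := eqVneq (order_part j a) 0; first by rewrite linear_map0.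
apply: (gf _ _ (elt_order_ge_order (order_part_order (i := j) a))).
(* Positivity of [j] keeps the truncated predecessor exact even when [n = 0]; a component of order
   zero vanishes. *)
have : (0 < j)%N.
  case: j nz {hw} => // /negP[]; apply/eqP/val_inj/funext => u.
  by rewrite order_partE; case: eqP => // hu; apply: Lhat_order_ge1; rewrite hu.
lia.
Qed.

Lemma lbracket_order_ge i j a b : elt_order_ge i a -> elt_order_ge j b ->
  elt_order_ge (i + j) (lbracket a b).
Proof.
move=> ha hb w hw; apply: bracket_eq0 => k hk.
have e1 := size_takel hk; have e2 := size_drop k w.
split.
- have [hl|hl] := ltnP k i; first by rewrite ha ?mul0r // e1.
  by rewrite (hb (drop k w)) ?mulr0 // e2; lia.
- have [hl|hl] := ltnP k j; first by rewrite hb ?mul0r // e1.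
  by rewrite (ha (drop k w)) ?mulr0 // e2; lia.
Qed.

Lemma lbracket_order i j a b : elt_order i a -> elt_order j b ->
  elt_order (i + j) (lbracket a b).
Proof.
move=> ha hb w hw; apply: bracket_eq0 => k hk.
have e1 := size_takel hk; have e2 := size_drop k w.
split.
- have [hl|hl] := eqVneq k i; last by rewrite ha ?mul0r // e1.
  by rewrite (hb (drop k w)) ?mulr0 // e2; lia.
- have [hl|hl] := eqVneq k j; last by rewrite hb ?mul0r // e1.
  by rewrite (ha (drop k w)) ?mulr0 // e2; lia.
Qed.

Lemma lbracket_linearl b : linear (fun a => lbracket a b).
Proof.
move=> k x y; apply: val_inj.
have := bracket_suml [:: k *: val x; val y] idfun (val b).
by rewrite !big_cons !big_nil !addr0 /= bracketZl.
Qed.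

Lemma lbracket_linearr b : linear (lbracket b).
Proof.
move=> k x y; apply: val_inj.
have := bracket_sumr [:: k *: val x; val y] idfun (val b).
by rewrite !big_cons !big_nil !addr0 /= bracketZr.
Qed.

(** In degree zero the Koszul sign is trivial, so the Leibniz rule extends additively from
    homogeneous [a] to all [a]. *)
Lemma vector_field0_lbracket f : vector_field 0 f -> forall a b,
  f (lbracket a b) = lbracket (f a) b + lbracket a (f b).
Proof.
move=> [lf _ _ hf] a b; move: a; apply: Lhat_homog_ind => [p a ha|a a' ha ha'].
  by rewrite (hf p) // mul0r expr0 scale1r.
have lb c := linear_mapD (lbracket_linearl c).
by rewrite /= in lb; rewrite lb !linear_mapD // ha ha' !lb addrACA.
Qed.

End LieElements.

(** * Exponentials of vector fields *)

Section SummationLemmas.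
Variables (U : zmodType).

(** Regroups the square by antidiagonals [i + j = k], as in a Cauchy product of truncated series. *)
Lemma triangular_sum N (F : nat -> nat -> U) :
  (forall i j, (N <= i + j)%N -> F i j = 0) ->
  \sum_(i < N) \sum_(j < N) F i j =
  \sum_(k < N) \sum_(i < k.+1) F i (k - i)%N.
Proof.
move=> F0; symmetry.
transitivity (\sum_(k < N) \sum_(i < N | (i < k.+1)%N) F i (k - i)%N).
  apply: eq_bigr => k _.
  by rewrite (big_ord_widen_cond N predT (fun i => F i (k - i)%N)).
rewrite (exchange_big_dep xpredT) //=; apply: eq_bigr => i _.
rewrite -(big_mkord (fun k => (i <= k)%N) (fun k => F i (k - i)%N)).
rewrite -(big_mkord predT (F i)) (@big_cat_nat _ _ _ i) //= ?(ltnW (ltn_ord i)) //.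
rewrite [X in X + _]big_nat_cond [X in X + _]big1 ?add0r; last first.
  by move=> k /andP[/andP[_ ki] ik]; move: ki; rewrite ltnNge ik.
rewrite -{1}[i : nat]add0n big_addn.
rewrite [RHS](@big_cat_nat _ _ _ (N - i)) ?leq_subr //=.
rewrite [X in _ = _ + X]big_nat_cond [X in _ = _ + X]big1 ?addr0; last first.
  by move=> j /andP[/andP[hj _] _]; apply: F0; rewrite -leq_subLR.
by apply: eq_big => [j|j _]; rewrite ?leq_addl ?addnK.
Qed.

(** Pascal's rule, in the form of the inductive step of the higher Leibniz formula. *)
Lemma pascal_sum k (F : nat -> nat -> U) :
  \sum_(i < k.+1) (F i.+1 (k - i)%N + F i (k.+1 - i)%N) *+ 'C(k, i) =
  \sum_(i < k.+2) F i (k.+1 - i)%N *+ 'C(k.+1, i).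
Proof.
rewrite [RHS]big_ord_recl /= bin0 subn0.
under [X in _ = _ + X]eq_bigr => i _ do
  rewrite [bump _ _]add1n binS subSS mulrnDr.
rewrite [in RHS]big_split /=; under eq_bigr do rewrite mulrnDl.
rewrite big_split /= addrC [X in X + _](_ : _ =
  \sum_(i < k.+2) F i (k.+1 - i)%N *+ 'C(k, i)); last first.
  by rewrite [RHS]big_ord_recr /= bin_small // mulr0n addr0.
by rewrite [X in X + _]big_ord_recl /= bin0 subn0 -addrA; congr (_ + (_ + _)).
Qed.

End SummationLemmas.

(** * The filtration of endomorphisms by order *)

Section OrderFiltration.
Variables (K : comNzRingType) (G : even_grading K) (V : free_graded).
Local Notation L := (Lhat G V).
Implicit Types (a b : L) (f g : L -> L).

Lemma order_geW k l f : (k <= l)%N -> order_ge l f -> order_ge k f.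
Proof. by move=> kl h i a ha; apply: elt_order_geW (h i a ha); lia. Qed.

Lemma order_geB n f g : order_ge n f -> order_ge n g -> order_ge n (f - g).
Proof. by move=> hf hg i a ha; apply: elt_order_geB; [exact: hf|exact: hg]. Qed.

Lemma order_geD n f g : order_ge n f -> order_ge n g -> order_ge n (f + g).
Proof. by move=> hf hg i a ha; apply: elt_order_geD; [exact: hf|exact: hg]. Qed.

(** Order [q] raises the order of elements by [q - 1], so a composite has order [p + q - 1]; a
    positive [q] keeps the truncated predecessor exact. *)
Lemma order_ge_comp n p q f g : (0 < q)%N -> (n < p + q)%N ->
  order_ge p f -> order_ge q g -> order_ge n (f \o g).
Proof.
move=> q0 npq hf hg i a ha; apply: elt_order_geW (hf _ _ (hg _ _ ha)); lia.
Qed.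

Lemma order_ge_id : order_ge 1 (id : L -> L).
Proof. by move=> i a ha; rewrite addn1. Qed.

Lemma order_ge_iter k f : order_ge 1 f -> order_ge 1 (iter k f).
Proof.
move=> hf; elim: k => [|k IH]; first exact: order_ge_id.
exact: (order_ge_comp (p := 1) (q := 1)).
Qed.

Lemma elt_order_geZ n k a : elt_order_ge n a -> elt_order_ge n (k *: a).
Proof.
move=> ha w hw; rewrite (_ : val (k *: a) w = k * val a w) //.
by rewrite ha // mulr0.
Qed.

Lemma elt_order_ge_sum n (I : Type) (s : seq I) (F : I -> L) :
  (forall i, elt_order_ge n (F i)) -> elt_order_ge n (\sum_(i <- s) F i).
Proof.
move=> h; apply: (big_ind (elt_order_ge n)) => //.
exact: elt_order_geD.
Qed.

Lemma vector_field_order_ge d n f :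
  vector_field d f -> has_order n f -> order_ge n f.
Proof. by case=> lf cf _ _; apply: has_order_order_ge. Qed.

Lemma vector_fieldN d f : vector_field d f -> vector_field d (- f).
Proof. by rewrite -sub0r; apply: vector_fieldB; apply: vector_field0. Qed.

Lemma vector_fieldD d f g :
  vector_field d f -> vector_field d g -> vector_field d (f + g).
Proof.
by move=> hf hg; rewrite -[g]opprK; apply: vector_fieldB => //; apply: vector_fieldN.
Qed.

Lemma has_orderB n f g : has_order n f -> has_order n g -> has_order n (f - g).
Proof. by move=> hf hg i a ha w hw; rewrite LhatB (hf i) ?(hg i) ?subrr. Qed.

Lemma has_orderN n f : has_order n f -> has_order n (- f).
Proof.
move=> hf i a ha w hw; rewrite (_ : val _ w = - val (f a) w) //.
by rewrite (hf i) ?oppr0.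
Qed.

End OrderFiltration.

(** * The exponential series of a vector field of degree zero *)

Section Exponential.
Variables (K : comNzRingType) (G : even_grading K) (iota : {rmorphism rat -> K}).
Variable (V : free_graded).
Local Notation L := (Lhat G V).

Definition inv_fact (k : nat) : K := iota (k`!%:R^-1).

Lemma factr_neq0 k : k`!%:R != 0 :> rat.
Proof. by rewrite Num.Theory.pnatr_eq0 -lt0n fact_gt0. Qed.

Lemma inv_fact_gr k : G 0 (inv_fact k).
Proof.
apply: (@gr0_inv _ _ (k`!%:R)); first exact: gr_nat.
by rewrite -(rmorph_nat iota) -rmorphM mulfV ?factr_neq0 ?rmorph1.
Qed.

Lemma inv_fact_bin k i : (i <= k)%N ->
  inv_fact k *+ 'C(k, i) = inv_fact i * inv_fact (k - i)%N.
Proof.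
move=> ik; rewrite /inv_fact -rmorphM -rmorphMn; congr (iota _).
apply: (mulfI (factr_neq0 k)); rewrite -[_ *+ 'C(_, _)]mulr_natr.
rewrite mulrA mulfV ?factr_neq0 // mul1r.
rewrite -(bin_fact ik) !natrM -[RHS]mulrA [X in _ = _ * X]mulrACA.
by rewrite !mulfV ?factr_neq0 ?mulr1.
Qed.

Lemma inv_fact0 : inv_fact 0 = 1.
Proof. by rewrite /inv_fact fact0 invr1 rmorph1. Qed.

Lemma inv_fact1 : inv_fact 1 = 1.
Proof. by rewrite /inv_fact factS fact0 invr1 rmorph1. Qed.

Definition exp_trunc (D : L -> L) (N : nat) (a : L) : L :=
  \sum_(k < N) inv_fact k *: iter k D a.

(** For [D] in [(2)] this is the full exponential series: [iter k D] lands in order at least [k], so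
    the terms with [k > N] vanish on words of length [N]. *)
Definition exp_map (D : L -> L) : L -> L := diag_map (fun N => exp_trunc D N.+1).

Section OneField.
Variable (D : L -> L).
Hypotheses (vD : vector_field 0 D) (oD : order_ge 2 D).

Let lD : linear D. Proof. by case: vD. Qed.

Lemma iter_linear k : linear (iter k D).
Proof. by elim: k => [|k IH] // c a b; rewrite !iterS IH lD. Qed.

Lemma iter_degree k : has_degree 0 (iter k D).
Proof.
case: vD => _ _ dD _; elim: k => [|k IH] p a ha; first by rewrite addr0.
by have := dD _ _ (IH _ _ ha); rewrite addr0.
Qed.

Lemma iter_continuous k : continuous_map (iter k D).
Proof.
case: vD => _ cD _ _; elim: k => [|k IH]; first exact: continuous_id.
exact: (continuous_comp cD IH).
Qed.

Lemma iter_order_ge k (a : L) : elt_order_ge k (iter k D a).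
Proof. by elim: k => [|k IH] //; have := oD IH; rewrite addn2. Qed.

Lemma iter_lbracket k (a b : L) : iter k D (lbracket a b) =
  \sum_(i < k.+1) lbracket (iter i D a) (iter (k - i)%N D b) *+ 'C(k, i).
Proof.
elim: k => [|k IH]; first by rewrite big_ord_recl big_ord0 addr0 bin0.
rewrite iterS IH linear_map_sum //.
rewrite -(pascal_sum k (fun i j => lbracket (iter i D a) (iter j D b))).
apply: eq_bigr => i _.
rewrite -scaler_nat linear_mapZ // scaler_nat vector_field0_lbracket //.
by rewrite -!iterS subSn // -ltnS.
Qed.

Lemma exp_trunc_linear N : linear (exp_trunc D N).
Proof.
move=> c a b; rewrite /exp_trunc scaler_sumr -big_split; apply: eq_bigr => k _ /=.
by rewrite iter_linear scalerDr !scalerA mulrC.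
Qed.

Lemma exp_trunc_degree N : has_degree 0 (exp_trunc D N).
Proof.
move=> p a ha w; rewrite Lhat_sum; apply: gr_sum => k _.
rewrite (_ : val _ w = inv_fact k * val (iter k D a) w) //.
by rewrite -[_ - _]add0r; apply: grM; [exact: inv_fact_gr|exact: iter_degree].
Qed.

Lemma exp_trunc_continuous N : continuous_map (exp_trunc D N).
Proof.
elim: N => [|N IH].
  by move=> w; exists [::] => a _; rewrite /exp_trunc big_ord0.
rewrite (_ : exp_trunc D N.+1 = inv_fact N *: iter N D + exp_trunc D N).
  by apply: continuous_addZ => //; exact: iter_continuous.
by apply/funext => a; rewrite /exp_trunc big_ord_recr addrC.
Qed.

Lemma exp_mapE N (a : L) w : (size w < N)%N ->
  val (exp_map D a) w = val (exp_trunc D N a) w.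
Proof.
move=> hN; rewrite diag_mapE; [|by move=> ?; exact: exp_trunc_linear|
  by move=> ?; exact: exp_trunc_degree].
rewrite !Lhat_sum -!(big_mkord xpredT (fun k => val (inv_fact k *: iter k D a) w)).
rewrite [RHS](@big_cat_nat _ _ _ (size w).+1) //= [X in _ + X]big_nat_cond.
rewrite [X in _ + X]big1 ?addr0 // => k /andP[/andP[hk _] _].
by apply: elt_order_geZ hk; exact: iter_order_ge.
Qed.

Lemma exp_map_linear : linear (exp_map D).
Proof.
by apply: diag_map_linear => N; [exact: exp_trunc_linear|exact: exp_trunc_degree].
Qed.

(** Divided by [k!], the higher Leibniz formula [iter_lbracket] is the degree [k] term of the Cauchy
    product of the two exponential series. *)
Lemma exp_map_lbracket (a b : L) :
  exp_map D (lbracket a b) = lbracket (exp_map D a) (exp_map D b).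
Proof.
apply: val_inj; apply/funext => w; set N := (size w).+1.
rewrite (@exp_mapE N) //.
(* The bracket at [w] reads its arguments only on prefixes and suffixes of [w], so one truncation
   length serves both factors. *)
transitivity (val (lbracket (exp_trunc D N a) (exp_trunc D N b)) w); last first.
  apply: bracket_loc => k; split; symmetry; apply: exp_mapE;
  by rewrite ltnS ?size_take_min ?size_drop ?geq_minr ?leq_subr.
have lbl (c : L) := lbracket_linearl c; have lbr (c : L) := lbracket_linearr c.
rewrite [exp_trunc D N a in RHS]/exp_trunc (linear_map_sum (lbl _)) !Lhat_sum.
transitivity (\sum_(i < N) \sum_(j < N) (inv_fact i * inv_fact j) *
  val (lbracket (iter i D a) (iter j D b)) w); last first.
  apply: eq_bigr => i _; rewrite [X in lbracket _ X]/exp_trunc.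
  rewrite (linear_map_sum (lbr _)) Lhat_sum; apply: eq_bigr => j _.
  by rewrite (linear_mapZ (lbl _)) (linear_mapZ (lbr _)) scalerA.
rewrite (triangular_sum (F := fun i j => inv_fact i * inv_fact j *
  val (lbracket (iter i D a) (iter j D b)) w)); last first.
  move=> i j hij; rewrite (@lbracket_order_ge _ _ _ i j) ?mulr0 //;
  exact: iter_order_ge.
apply: eq_bigr => k _; rewrite iter_lbracket scaler_sumr Lhat_sum.
apply: eq_bigr => i _; rewrite -scalerMnr scalerMnl inv_fact_bin //.
by rewrite -ltnS.
Qed.

Lemma exp_map_lie_hom : lie_hom (exp_map D).
Proof.
split; [exact: exp_map_linear| | |exact: exp_map_lbracket].
  apply: diag_map_continuous => N;
  [exact: exp_trunc_linear|exact: exp_trunc_degree|exact: exp_trunc_continuous].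
by apply: diag_map_degree => N; [exact: exp_trunc_linear|exact: exp_trunc_degree].
Qed.

(** The terms beyond the linear one apply [D] at least twice, raising the order by at least
    [2 (k - 1)], which is at least [k] as [k >= 2]. *)
Lemma exp_map_leading k : (1 < k)%N -> order_ge k D ->
  order_ge k.+1 (exp_map D - id - D).
Proof.
move=> k1 kD i a ha w hw.
rewrite !LhatB (@exp_mapE (size w).+3); last by rewrite ltnW.
rewrite /exp_trunc 2!big_ord_recl !LhatD inv_fact0 inv_fact1 !scale1r.
rewrite [X in _ + (_ + X)](_ : _ = 0).
  by rewrite addr0 addrAC addrK subrr.
rewrite Lhat_sum big1 // => j _ /=; apply: (elt_order_geZ (n := (i + k.+1).-1)) hw.
rewrite add0n -!iterS !iterSr.
have o1 : order_ge 1 D by exact: order_geW oD.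
have := order_ge_iter j o1 (kD _ _ (kD _ _ ha)); rewrite addn1 /=.
by apply: elt_order_geW; lia.
Qed.

Lemma iter_opp j (a : L) : iter j (- D) a = (-1) ^+ j *: iter j D a.
Proof.
elim: j => [|j IH]; first by rewrite scale1r.
rewrite iterS IH (_ : (- D) _ = - D ((-1) ^+ j *: iter j D a)) //.
by rewrite linear_mapZ // exprS mulN1r scaleNr.
Qed.


End OneField.

(** In the product of the two series the coefficient of [iter k D] is [(1 - 1) ^ k / k!], which
    vanishes for [k > 0]. *)
Lemma exp_mapK (D : L -> L) : vector_field 0 D -> order_ge 2 D ->
  cancel (exp_map D) (exp_map (- D)).
Proof.
move=> vD oD a.
have lD : linear D by case: vD.
have vN := vector_fieldN vD.
have oN : order_ge 2 (- D) by rewrite -sub0r; apply: order_geB => // i b _.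
apply: val_inj; apply/funext => w; set N := (size w).+1.
rewrite (@exp_mapE _ vN oN N) //.
have lN : linear (exp_trunc (- D) N) := exp_trunc_linear vN N.
(* The tail of the inner series has order at least [N], and [- D] does not lower orders, so the tail
   is invisible at [w]. *)
have -> : val (exp_trunc (- D) N (exp_map D a)) w =
          val (exp_trunc (- D) N (exp_trunc D N a)) w.
  apply/eqP; rewrite -subr_eq0 -LhatB -linear_subr //; apply/eqP.
  have hN : elt_order_ge N (exp_map D a - exp_trunc D N a).
    by move=> u hu; rewrite LhatB (exp_mapE vD oD _ hu) subrr.
  have o1 : order_ge 1 (- D) by exact: order_geW oN.
  apply: (elt_order_ge_sum (n := N)) (ltnSn _) => k.
  apply: elt_order_geZ; have := order_ge_iter k o1 hN.
  by rewrite addn1.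
transitivity (\sum_(i < N) \sum_(j < N)
    ((-1) ^+ i * (inv_fact i * inv_fact j)) * val (iter (i + j) D a) w).
  rewrite [exp_trunc (- D) N _]/exp_trunc Lhat_sum; apply: eq_bigr => i _.
  rewrite iter_opp // [exp_trunc D N a]/exp_trunc.
  rewrite (linear_map_sum (iter_linear vD i)) !scaler_sumr Lhat_sum.
  apply: eq_bigr => j _.
  rewrite (linear_mapZ (iter_linear vD i)) -iterD !scalerA.
  by congr (_ * _); rewrite mulrCA mulrA.
rewrite (triangular_sum (F := fun i j =>
    ((-1) ^+ i * (inv_fact i * inv_fact j)) * val (iter (i + j) D a) w)); last first.
  by move=> i j hij; rewrite (iter_order_ge oD) ?mulr0.
rewrite big_ord_recl [X in _ + X]big1 ?addr0 => [|k _].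
  by rewrite /= big_ord_recl big_ord0 addr0 /= inv_fact0 !mul1r.
rewrite /= /bump leq0n add1n.
transitivity (inv_fact k.+1 * (\sum_(i < k.+2) (-1) ^+ i *+ 'C(k.+1, i)) *
              val (iter k.+1 D a) w).
  rewrite mulr_sumr mulr_suml; apply: eq_bigr => i _.
  have ik : (i <= k.+1)%N by rewrite -ltnS.
  by rewrite subnKC // -inv_fact_bin // !mulrnAr [(-1) ^+ i * _]mulrC.
have := exprBn (1 : K) 1 k.+1; rewrite subrr expr0n /= => e.
rewrite [X in _ * X * _](_ : _ = 0) ?mulr0 ?mul0r // [RHS]e.
by apply: eq_bigr => i _; rewrite !expr1n !mulr1.
Qed.

Lemma exp_map_diffeo (D : L -> L) : vector_field 0 D -> order_ge 2 D ->
  diffeo (exp_map D) (exp_map (- D)).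
Proof.
move=> vD oD; have vN := vector_fieldN vD.
have oN : order_ge 2 (- D) by rewrite -sub0r; apply: order_geB => // i b _.
split; [exact: exp_map_lie_hom|exact: exp_map_lie_hom|exact: exp_mapK|].
by rewrite -{2}[D]opprK; exact: exp_mapK.
Qed.

End Exponential.

(** * Leading parts of diffeomorphisms *)

Section LeadingPart.
Variables (K : comNzRingType) (G : even_grading K) (V : free_graded).
Local Notation L := (Lhat G V).
Implicit Types (a b : L).

(* For [f] in [(k)], the homogeneous component of [f] of order exactly [k]. *)
Definition leading_part (k : nat) (f : L -> L) : L -> L :=
  diag_map (fun N => f \o order_part (N.+1 - k)).

Lemma order_part_eq0 i a : elt_order_ge i.+1 a -> order_part i a = 0.
Proof.
move=> ha; apply: val_inj; apply/funext => u; rewrite order_partE.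
by case: eqP => // hu; apply: ha; rewrite hu.
Qed.

Section LinearMap.
Variables (k : nat) (f : L -> L).
Hypotheses (lf : linear f) (df : has_degree 0 f).

Let lT N : linear (f \o order_part (N.+1 - k)).
Proof. by move=> c a b /=; rewrite order_part_linear lf. Qed.

Let dT N : has_degree 0 (f \o order_part (N.+1 - k)).
Proof.
move=> p a ha; have := df (order_part_degree (N.+1 - k) ha).
by rewrite !addr0.
Qed.

Lemma leading_partE a w :
  val (leading_part k f a) w = val (f (order_part ((size w).+1 - k) a)) w.
Proof. exact: diag_mapE. Qed.

Lemma leading_part_linear : linear (leading_part k f).
Proof. exact: diag_map_linear. Qed.

Lemma leading_part_degree : has_degree 0 (leading_part k f).
Proof. exact: diag_map_degree. Qed.

Lemma leading_part_continuous : continuous_map f -> continuous_map (leading_part k f).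
Proof.
move=> cf; apply: diag_map_continuous => // N.
exact: continuous_comp cf (@order_part_continuous _ _ _ _).
Qed.

Lemma leading_part_order : has_order k (leading_part k f).
Proof.
move=> i a ha w hw; rewrite leading_partE.
suff -> : order_part ((size w).+1 - k) a = 0 by rewrite linear_map0.
apply: val_inj; apply/funext => u; rewrite order_partE; case: eqP => // hu.
(* Truncated subtraction can produce the index [0]; this is harmless, since elements of [L] vanish
   on the empty word. *)
have [u0|u0] := posnP (size u); first by apply: Lhat_order_ge1; rewrite u0.
by apply: ha; rewrite hu; move/eqP: hw => hw; apply/eqP; lia.
Qed.

(** On a word shorter than [i + k] the subtracted component of [a] has order at most [i]. If it is
    [i], the rest of [a] has order at least [i + 1]; if it is smaller, that component is zero and
    [f a] already vanishes there. *)
Lemma leading_partB : (0 < k)%N -> order_ge k f ->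
  order_ge k.+1 (f - leading_part k f).
Proof.
move=> k0 kf i a ha w hw; rewrite LhatB leading_partE -LhatB -linear_subr //.
set j := ((size w).+1 - k)%N.
have [ij|ij] := eqVneq j i.
  apply: (kf i.+1) => [u hu|]; last by lia.
  rewrite LhatB order_partE; case: eqP => [_|hj]; first by rewrite subrr.
  by rewrite ha ?subr0 //; lia.
rewrite order_part_eq0 ?subr0; last by apply: elt_order_geW ha; lia.
by apply: (kf _ _ ha); lia.
Qed.

End LinearMap.

(** With [f = phi - id], multiplicativity of [phi] says that [f] satisfies the Leibniz rule up to
    [[f a, f b]], which is of higher order. The Leibniz defect [F] of the leading part therefore
    lies beyond its own order and is zero. *)
Lemma leading_part_vector_field k (phi : L -> L) : (1 < k)%N ->
  lie_hom phi -> eq_mod k phi id -> vector_field 0 (leading_part k (phi - id)).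
Proof.
move=> k1 [lphi cphi dphi hphi] kphi.
pose f := phi - id : L -> L.
have lf : linear f.
  by move=> c a b; rewrite /f !fctE lphi scalerBr opprD addrACA.
have df : has_degree 0 f.
  move=> p a ha w; rewrite LhatB; apply: grB; first exact: dphi.
  by rewrite addr0.
have cf : continuous_map f.
  rewrite (_ : f = (-1) *: id + phi); last by rewrite scaleN1r addrC.
  exact: continuous_addZ (@continuous_id _ _ _) cphi.
set D := leading_part k f.
have lD : linear D by exact: leading_part_linear.
have oD : has_order k D by exact: leading_part_order.
have cD : continuous_map D by exact: leading_part_continuous.
have gD : order_ge k D := has_order_order_ge lD cD oD.
split=> // [|p a b _]; first exact: leading_part_degree.
rewrite mul0r expr0 scale1r.
have lbl (c : L) := lbracket_linearl c; have lbr (c : L) := lbracket_linearr c.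
pose F a b := D (lbracket a b) - (lbracket (D a) b + lbracket a (D b)).
suff : F a b = 0 by move/eqP; rewrite subr_eq0 => /eqP.
have lFl c : linear (F^~ c).
  move=> t x y; rewrite /F lbl !lD !lbl.
  by rewrite [X in _ - X]addrACA -scalerDr opprD addrACA -scalerBr.
have lFr c : linear (F c).
  move=> t x y; rewrite /F lbr !lD !lbr.
  by rewrite [X in _ - X]addrACA -scalerDr opprD addrACA -scalerBr.
have FE c d : F c d = lbracket (f c) (f d) - (f - D) (lbracket c d) +
    (lbracket ((f - D) c) d + lbracket c ((f - D) d)).
  rewrite /F /f !fctE hphi !lbracketBl !lbracketBr.
  by apply: val_inj; apply/funext => w; rewrite !(LhatB, LhatD); ring.
(* The quadratic term [[f c, f d]] has order at least [i + j + 2k - 2], and [2k - 2 >= k] since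
   [k >= 2]. *)
have Fge i j c d : elt_order_ge i c -> elt_order_ge j d ->
    elt_order_ge (i + j + k) (F c d).
  have gfD : order_ge k.+1 (f - D) by apply: leading_partB => //; exact: ltnW.
  move=> hc hd; rewrite FE; apply: elt_order_geD; first apply: elt_order_geB.
  - apply: elt_order_geW (lbracket_order_ge (kphi _ _ hc) (kphi _ _ hd)); lia.
  - apply: elt_order_geW (gfD _ _ (lbracket_order_ge hc hd)); lia.
  apply: elt_order_geD.
  - apply: elt_order_geW (lbracket_order_ge (gfD _ _ hc) hd); lia.
  - apply: elt_order_geW (lbracket_order_ge hc (gfD _ _ hd)); lia.
(* On arguments of pure orders the defect has exact order [i + j + k - 1], just below the bound of
   [Fge]. *)
have F0 i j c d : elt_order i c -> elt_order j d -> F c d = 0.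
  move=> hc hd; apply: val_inj; apply/funext => w.
  have [hw|hw] := ltnP (size w) (i + j + k).
    by apply: (Fge i j) hw; exact: elt_order_ge_order.
  have h1 : size w != (i + j + k).-1 by apply/eqP; lia.
  rewrite LhatB LhatD (oD _ _ (lbracket_order hc hd)) //.
  rewrite (lbracket_order (oD _ _ hc) hd) ?(lbracket_order hc (oD _ _ hd)).
  - by rewrite addr0 subr0.
  - by apply/eqP; lia.
  - by apply/eqP; lia.
(* [Fge] with order [0] for the other argument controls the tails, so first [a] and then [b] may be
   replaced by their order components. *)
apply: val_inj; apply/funext => w.
apply: (@linear_eq0_order_parts _ _ _ (F^~ b) a w (size w).+1) => //.
  move=> c hc; have b0 : elt_order_ge 0 b by [].
  by apply: (Fge _ _ _ _ hc b0); lia.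
move=> i; apply: (@linear_eq0_order_parts _ _ _ (F _) b w (size w).+1) => //.
  move=> c hc; have a0 : elt_order_ge 0 (order_part i a) by [].
  by apply: (Fge _ _ _ _ a0 hc); lia.
move=> j; rewrite (@F0 i j) //; exact: order_part_order.
Qed.

End LeadingPart.

(** * Extensions and coboundaries *)

Section Extensions.
Variables (K : comNzRingType) (G : even_grading K) (iota : {rmorphism rat -> K}).
Variable (V : free_graded).
Local Notation L := (Lhat G V).
Variables (A : graded_comm_alg G V).
Local Notation m2 := (m2_of A).

Let lA : linear m2. Proof. by case: A => ? []. Qed.

Lemma comm_alg_order_ge : order_ge 2 m2.
Proof. by case: A => f vf of_ sq; exact: vector_field_order_ge vf of_. Qed.

(* Conjugating by [id + D + (order >= n)], with [D] of order [>= n - 1], changes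
   a vector field with quadratic part [m2] by [-[m2, D]] modulo [(n + 1)]. *)
Lemma conj_first_order n (phi D M M' : L -> L) : (2 < n)%N ->
  linear D -> linear M' -> order_ge n.-1 D -> order_ge n (phi - id - D) ->
  order_ge 3 (M - m2) -> order_ge 3 (M' - m2) ->
  order_ge n.+1 ((phi \o M) - (M' \o phi) - (M - M' - ((m2 \o D) - (D \o m2)))).
Proof.
move=> n2 lD lM' oD orho oM oM'.
have oA := comm_alg_order_ge.
have order2 f : order_ge 3 (f - m2) -> order_ge 2 f.
  move=> h; rewrite -[f](subrK m2); apply: order_geD => //.
  exact: order_geW h.
set rho := phi - id - D.
(* After cancellation four composites remain, of orders [(n - 1) + 3 - 1] or [n + 2 - 1], that is
   [n + 1]. *)
rewrite (_ : _ - _ = (D \o (M - m2)) + (rho \o M) - ((M' - m2) \o D)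
                  - (M' \o rho)).
  apply: order_geB; first apply: order_geB; first apply: order_geD.
  - by apply: (order_ge_comp _ _ oD oM) => //; lia.
  - by apply: (order_ge_comp _ _ orho (order2 _ oM)) => //; lia.
  - by apply: (order_ge_comp _ _ oM' oD); lia.
  - by apply: (order_ge_comp _ _ (order2 _ oM') orho); lia.
apply/funext => a; rewrite /rho !fctE /= (linear_subr lD) !(linear_subr lM').
by apply: val_inj; apply/funext => w; rewrite !(LhatB, LhatD); ring.
Qed.

(** Composition on the right with [phi] or [psi] preserves the filtration, so the conjugation
    congruence can be tested without the inverse. *)
Lemma order_ge_conj_inv n (phi psi M M' : L -> L) :
  cancel phi psi -> cancel psi phi -> order_ge 1 phi -> order_ge 1 psi ->
  eq_mod n (phi \o M \o psi) M' <-> order_ge n ((phi \o M) - (M' \o phi)).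
Proof.
move=> phiK psiK o1 o2; rewrite /eq_mod; split=> h.
  rewrite (_ : _ - _ = ((phi \o M \o psi) - M') \o phi).
    by apply: order_ge_comp h o1; lia.
  by apply/funext => a; rewrite !fctE /= phiK.
rewrite (_ : _ - _ = ((phi \o M) - (M' \o phi)) \o psi).
  by apply: order_ge_comp h o2; lia.
by apply/funext => a; rewrite !fctE /= psiK.
Qed.

Lemma quadratic_part_order n (m : L -> L) :
  (2 < n)%N -> quadratic_part n m m2 -> order_ge 3 (m - m2).
Proof.
move=> n2 [m_ [hm ->] <-]; rewrite big_ltn // addrC addKr big_seq.
apply: (big_ind (order_ge 3)) => [//|f g|i]; first exact: order_geD.
rewrite mem_index_iota => /andP[i3 iN].
have [vi oi] := hm i (introT andP (conj (ltnW i3) iN)).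
by apply: order_geW i3 _; apply: vector_field_order_ge vi oi.
Qed.

Lemma linearB (f g : L -> L) : linear f -> linear g -> linear (f - g).
Proof.
by move=> lf lg c a b; rewrite !fctE lf lg scalerBr opprD addrACA.
Qed.

Lemma continuousB (f g : L -> L) :
  continuous_map f -> continuous_map g -> continuous_map (f - g).
Proof.
by move=> cf cg; rewrite addrC -scaleN1r; apply: continuous_addZ.
Qed.

Lemma linear_comp (f g : L -> L) : linear f -> linear g -> linear (f \o g).
Proof. by move=> lf lg c a b; rewrite /= lg lf. Qed.

Lemma has_order_comp p q n (f g : L -> L) : (0 < q)%N -> (p + q)%N = n.+1 ->
  has_order p f -> has_order q g -> has_order n (f \o g).
Proof.
move=> q0 pq hf hg i a ha.
by rewrite (_ : (i + n).-1 = ((i + q).-1 + p).-1); [exact: hf (hg _ _ ha)|lia].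
Qed.

Let vA : vector_field 1 m2. Proof. by case: A. Qed.
Let oA : has_order 2 m2. Proof. by case: A. Qed.
Let cA : continuous_map m2. Proof. by case: vA. Qed.

Lemma conj_equiv_extP n (m mn mn' : L -> L) : (2 < n)%N ->
  quadratic_part n m m2 -> is_extension n m mn -> is_extension n m mn' ->
  conj_equiv n.-1 n.+1 (m + mn) (m + mn') <->
  exists D, [/\ vector_field 0 D, has_order n.-1 D &
                 mn' - mn = (m2 \o D) - (D \o m2)].
Proof.
move=> n2 qm [vmn omn [vM _ _]] [vmn' omn' [vM' _ _]].
have om := quadratic_part_order n2 qm.
have M3 f : vector_field 1 f -> has_order n f -> order_ge 3 (m + f - m2).
  move=> vf hf; rewrite addrAC; apply: order_geD => //.
  exact: order_geW (vector_field_order_ge vf hf).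
have oM := M3 _ vmn omn; have oM' := M3 _ vmn' omn'.
have lM' : linear (m + mn') by case: vM'.
have ME : m + mn - (m + mn') = mn - mn' by rewrite opprD addrACA subrr add0r.
have n1 : (1 < n.-1)%N by lia.
have nE : n.-1.+1 = n by lia.
split=> [[phi [psi [dphi e1 e2]]]|[D [vD oD DE]]].
- have [hphi hpsi phiK psiK] := dphi.
  have vD := leading_part_vector_field n1 hphi e1.
  set D := leading_part _ _ in vD.
  have [lphi cphi dphi0 _] := hphi.
  have [lD cD _ _] := vD.
  have lf : linear (phi - id) by apply: linearB.
  have df : has_degree 0 (phi - id).
    move=> p a ha w; rewrite LhatB; apply: grB; first exact: dphi0.
    by rewrite addr0.
  have oD : has_order n.-1 D by exact: leading_part_order.
  have o2 : eq_mod 2 phi id by exact: eq_modW e1.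
  have o1 := eq_mod_id_order o2; have o1' := inverse_order psiK o2.
  have h := proj1 (order_ge_conj_inv _ _ _ phiK psiK o1 o1') e2.
  have orho : order_ge n (phi - id - D).
    rewrite -[X in order_ge X]nE; apply: leading_partB => //; lia.
  have gD := vector_field_order_ge vD oD.
  (* Subtracting the two estimates leaves [mn - mn' - [m2, D]] in order at least [n + 1]. It also
     has exact order [n], so it is zero, and [- D] is the witness for [mn' - mn]. *)
  have := order_geB h (conj_first_order n2 lD lM' gD orho oM oM').
  rewrite opprB addrC subrK ME => oE.
  exists (- D); split; [exact: vector_fieldN|exact: has_orderN|].
  have /eqP : mn - mn' - ((m2 \o D) - (D \o m2)) = 0.
    have [[lmn cmn _ _] [lmn' cmn' _ _]] := (vmn, vmn').
    apply: has_order_eq0 oE.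
    + by do 2?apply: linearB => //; apply: linear_comp.
    + by do 2?apply: continuousB => //; apply: continuous_comp.
    + apply: has_orderB; first exact: has_orderB.
      by apply: has_orderB; [apply: has_order_comp oA oD|apply: has_order_comp oD oA];
         lia.
  rewrite subr_eq0 => /eqP e; rewrite -opprB e.
  by apply/funext => a; rewrite !fctE /= (linear_mapN lA) opprB opprK addrC.
(* The exponential of [- D] has leading part [- D], so conjugation by it adds [[m2, D]], which is
   [mn' - mn]. *)
- have vN := vector_fieldN vD.
  have oN := has_orderN oD.
  have gN := vector_field_order_ge vN oN.
  have gN2 : order_ge 2 (- D) by exact: order_geW gN.
  have dphi := exp_map_diffeo iota vN gN2.
  have [_ _ phiK psiK] := dphi.
  have lead := exp_map_leading iota vN gN2 n1 gN; rewrite nE in lead.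
  have e1 : eq_mod n.-1 (exp_map iota (- D)) id.
    rewrite /eq_mod -[_ - _](subrK (- D)); apply: order_geD => //.
    by apply: order_geW lead; lia.
  exists (exp_map iota (- D)), (exp_map iota (- - D)); split=> //.
  have o2 : eq_mod 2 (exp_map iota (- D)) id by exact: eq_modW e1.
  have o1 := eq_mod_id_order o2; have o1' := inverse_order psiK o2.
  apply/(order_ge_conj_inv _ _ _ phiK psiK o1 o1').
  have [lN _ _ _] := vN.
  have := conj_first_order n2 lN lM' gN lead oM oM'.
  rewrite ME -[mn - mn']opprB DE.
  rewrite [X in _ - X](_ : _ = 0) ?subr0 //.
  by apply/funext => a; rewrite !fctE /= (linear_mapN lA) opprK opprB [- _ + _]addrC subrr.
Qed.

(** Both [m2] and [x] are odd, so [[m2, x]] is the anticommutator. It has exact order [n + 1], so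
    its vanishing modulo [(n + 2)] is genuine vanishing. *)
Lemma is_extension_addP n (m mn x : L -> L) : (2 < n)%N ->
  quadratic_part n m m2 -> minimal_C n m -> is_extension n m mn ->
  vector_field 1 x -> has_order n x ->
  is_extension n m (mn + x) <-> (m2 \o x) + (x \o m2) = 0.
Proof.
move=> n2 qm [vm _ _] [vmn omn [vM _ sqM]] vx ox.
have vy : vector_field 1 (mn + x) by exact: vector_fieldD.
have oy : has_order n (mn + x).
  by rewrite -[x]opprK; apply: has_orderB => //; exact: has_orderN.
have om := quadratic_part_order n2 qm.
have gx := vector_field_order_ge vx ox.
have gmn := vector_field_order_ge vmn omn.
have gy := vector_field_order_ge vy oy.
have [lm _ _ _] := vm; have [lmn _ _ _] := vmn; have [lx cx _ _] := vx.
(* The remaining terms pair [x] with [m - m2], of order [n + 2], or with [mn] and [mn + x], of order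
   [2n - 1], which is at least [n + 2] because [n >= 3]. *)
have defect : order_ge n.+2 (((m + (mn + x)) \o (m + (mn + x))) -
    ((m + mn) \o (m + mn)) - ((m2 \o x) + (x \o m2))).
  rewrite (_ : _ - _ = ((m - m2) \o x) + (x \o (m - m2)) + (mn \o x) +
                       (x \o (mn + x))).
    apply: order_geD; first apply: order_geD; first apply: order_geD.
    - by apply: (order_ge_comp _ _ om gx); lia.
    - by apply: (order_ge_comp _ _ gx om); lia.
    - by apply: (order_ge_comp _ _ gmn gx); lia.
    - by apply: (order_ge_comp _ _ gx gy); lia.
  apply/funext => a; rewrite !fctE /= (linear_subr lx) !(linear_mapD lm) !(linear_mapD lx)
    !(linear_mapD lmn).
  by apply: val_inj; apply/funext => w; rewrite !(LhatB, LhatD); ring.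
split=> [[_ _ [_ _ sq]]|e].
- have := order_geB (order_geB sq sqM) defect; rewrite opprB addrC subrK => oE.
  apply: has_order_eq0 oE.
  + rewrite -[x \o _]opprK; apply: linearB; first exact: linear_comp.
    by move=> c a b; rewrite !fctE /= lA lx opprD scalerN.
  + rewrite -(scale1r (m2 \o x)); apply: continuous_addZ; exact: continuous_comp.
  + rewrite -[x \o _]opprK; apply: has_orderB; last apply: has_orderN.
      by apply: has_order_comp oA ox; lia.
    by apply: has_order_comp ox oA; lia.
- split=> //; split; first exact: vector_fieldD.
    have [m_ [hm mE] _] := qm.
    exists (fun i => if i == n then mn + x else m_ i); split.
      move=> i /andP[i2 iN]; case: eqP => [->//|/eqP i_n]; apply: hm.
      by rewrite i2 ltn_neqAle i_n -ltnS.
    rewrite big_nat_recr ?(ltnW n2) //= eqxx mE; congr (_ + _).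
    by apply: eq_big_nat => i /andP[_ iN]; rewrite ltn_eqF.
  by have := order_geD defect sqM; rewrite e subr0 subrK.
Qed.

End Extensions.

(** * Harrison classes and classes of extensions *)

Section ExtensionClasses.
Variables (K : comNzRingType) (G : even_grading K) (iota : {rmorphism rat -> K}).
Variable (V : free_graded).
Local Notation L := (Lhat G V).
Variables (A : graded_comm_alg G V).
Local Notation m2 := (m2_of A).

Let lA : linear m2. Proof. by case: A => ? []. Qed.

(** Coboundaries of bidegree [(n, 2)], phrased for bare endomorphisms so that one condition compares
    both cocycles and extensions. *)
Definition exact_field (n : nat) (f : L -> L) := exists D : L -> L,
  [/\ vector_field 0 D, has_order n.-1 D & f = (m2 \o D) - (D \o m2)].

Lemma exact_fieldB n f g : exact_field n f -> exact_field n g -> exact_field n (f - g).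
Proof.
move=> [D [vD oD ->]] [D' [vD' oD' ->]]; exists (D - D').
split; [exact: vector_fieldB|exact: has_orderB|].
apply/funext => a; rewrite !fctE /= (linear_subr lA).
by apply: val_inj; apply/funext => w; rewrite !LhatB; ring.
Qed.

Lemma exact_field0 n : exact_field n 0.
Proof.
exists 0; split; [exact: vector_field0|by move=> i a _ w _|].
by apply/funext => a; rewrite !fctE /= linear_map0 // subrr.
Qed.

Lemma exact_fieldN n f : exact_field n f -> exact_field n (- f).
Proof. by rewrite -sub0r; apply: exact_fieldB; exact: exact_field0. Qed.

Local Notation field_of xi := (cochain_val (cocycle_val xi)).

Lemma differential_deg2 n (x : cochain G V n 2) :
  differential A x = (m2 \o cochain_val x) + (cochain_val x \o m2).
Proof.
apply/funext => a; rewrite /differential /commutator.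
by rewrite [absz _](_ : _ = 1%N) // expr1 scaleN1r opprK.
Qed.

Lemma differential_deg1 n (x : cochain G V n (2 - 1)) :
  differential A x = (m2 \o cochain_val x) - (cochain_val x \o m2).
Proof.
apply/funext => a; rewrite /differential /commutator.
by rewrite [absz _](_ : _ = 0%N) // expr0 scale1r.
Qed.

Lemma cocycleP n (xi : cocycle A n 2) :
  [/\ vector_field 1 (field_of xi), has_order n (field_of xi) &
      (m2 \o field_of xi) + (field_of xi \o m2) = 0].
Proof.
have /asboolP[v o] := valP (cocycle_val xi).
by split=> //; rewrite -differential_deg2; apply/eqP; exact: (valP xi).
Qed.

Lemma cocycle_ex n f : vector_field 1 f -> has_order n f ->
  (m2 \o f) + (f \o m2) = 0 -> exists xi : cocycle A n 2, field_of xi = f.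
Proof.
move=> vf of_ e.
have h : f \in @cochain_pred K G V n 2 by apply/asboolP.
have h' : Cochain h \in @cocycle_pred K G V A n 2.
  by apply/eqP; rewrite differential_deg2.
by exists (Cocycle h').
Qed.

Lemma coboundary_exactP n (xi : cocycle A n 2) : (0 < n)%N ->
  xi \in @coboundary_pred K G V A n 2 <-> exact_field n (field_of xi).
Proof.
move=> n0; split=> [/orP[/eqP ->|/asboolP[i [ni [eta ->]]]]|[D [vD oD e]]].
- exact: exact_field0.
- have /asboolP[v o] := valP eta; exists (cochain_val eta).
  by split; [exact: v|rewrite ni|rewrite differential_deg1].
- have h : D \in @cochain_pred K G V n.-1 (2 - 1) by apply/asboolP.
  apply/orP; right; apply/asboolP; exists n.-1; rewrite prednK //; split=> //.
  by exists (Cochain h); rewrite differential_deg1.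
Qed.

Lemma Harr_class_eqP n (x y : cocycle A n 2) : (0 < n)%N ->
  Harr_class x = Harr_class y <-> exact_field n (field_of x - field_of y).
Proof.
move=> n0; rewrite -(coboundary_exactP (x - y) n0) Quotient.idealrBE.
by split=> /eqP.
Qed.

(** Together with [Harr_class_eqP], this expresses both quotients by the same relation, exactness of
    a difference. *)
Lemma ext_class_eqP n (n3 : (3 <= n)%N) (m : L -> L) (x y : extension n m) :
  quadratic_part n m m2 ->
  ext_class n3 x = ext_class n3 y <-> exact_field n (ext_val y - ext_val x).
Proof.
move=> qm; have /asboolP hx := valP x; have /asboolP hy := valP y.
apply: iff_trans (conj_equiv_extP iota n3 qm hx hy).
split=> [/eqquotP/asboolP //|h].
by apply/eqquotP/asboolP.
Qed.

End ExtensionClasses.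

Theorem theorem9p12 (K : comNzRingType) (G : even_grading K)
    (iota : {rmorphism rat -> K}) (V : free_graded)
    (A : graded_comm_alg G V) (n : nat) (n_ge3 : (3 <= n)%N)
    (m : Lhat G V -> Lhat G V)
    (m_C : minimal_C n m) (m_A : quadratic_part n m A)
    (m_ext : extendable n m) :
  exists act : Harr A n 2 -> ext_classes n_ge3 m -> ext_classes n_ge3 m,
    [/\ forall (xi : cocycle A n 2) (mn : extension n m),
          exists2 mn' : extension n m,
            ext_val mn' = ext_val mn + cochain_val (cocycle_val xi) &
            act (Harr_class xi) (ext_class n_ge3 mn) = ext_class n_ge3 mn',
        is_action act, free_action act & transitive_action act].
Proof.
have n0 : (0 < n)%N by exact: ltn_trans n_ge3.
have extP (x y : extension n m) := ext_class_eqP iota n_ge3 x y m_A.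
have HarrP (x y : cocycle A n 2) := Harr_class_eqP x y n0.
have shiftP (xi : cocycle A n 2) (x : extension n m) :
    `[< is_extension n m (ext_val x + cochain_val (cocycle_val xi)) >].
  have [v o e] := cocycleP xi; have /asboolP hx := valP x.
  by apply/asboolP/(is_extension_addP n_ge3 m_A m_C hx v o).
(* The action is defined on chosen representatives; [actE] gives independence of the choice, since
   these differ from [x] and [xi] by exact fields. *)
pose act (h : Harr A n 2) (e : ext_classes n_ge3 m) : ext_classes n_ge3 m :=
  ext_class n_ge3 (Extension (shiftP (repr h) (repr e))).
have repr_ext (x : extension n m) : exact_field A n (ext_val x - ext_val (repr (ext_class n_ge3 x))).
  by apply/extP; exact: reprK.
have repr_Harr (xi : cocycle A n 2) : exact_field A n (cochain_val (cocycle_val (repr (Harr_class xi)))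
    - cochain_val (cocycle_val xi)).
  by apply/HarrP; exact: reprK.
have actE (xi : cocycle A n 2) (x : extension n m) : act (Harr_class xi) (ext_class n_ge3 x) =
    ext_class n_ge3 (Extension (shiftP xi x)).
  apply/extP => /=.
  have := exact_fieldB (repr_ext x) (repr_Harr xi).
  by rewrite opprB opprD addrACA [- _ + _]addrC.
have classK (e : ext_classes n_ge3 m) : ext_class n_ge3 (repr e) = e := reprK e.
have HarrK (h : Harr A n 2) : Harr_class (repr h) = h := reprK h.
have Harr0 : Harr_class (0 : cocycle A n 2) = 0 by rewrite /Harr_class raddf0.
have HarrD (x y : cocycle A n 2) : Harr_class (x + y) = Harr_class x + Harr_class y.
  by rewrite /Harr_class raddfD.
exists act; split.
- by move=> xi x; exists (Extension (shiftP xi x)).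
- split=> [e|x y e].
    rewrite -[e]classK -Harr0 actE; apply/extP => /=.
    by rewrite opprD addrA subrr sub0r; apply/exact_fieldN/exact_field0.
  rewrite -[e]classK -[x]HarrK -[y]HarrK -HarrD !actE; apply/extP => /=.
  by rewrite [X in X - _]addrAC -[X in X - _]addrA subrr; exact: exact_field0.
(* A fixed class makes the negative of a representative of [h] exact. *)
- move=> h e; rewrite -[e]classK -[h]HarrK actE => /extP /=.
  rewrite opprD addrA subrr sub0r => /exact_fieldN; rewrite opprK => hx.
  by rewrite -Harr0; apply/HarrP; rewrite subr0.
- have [mn0 /asboolP h0] := m_ext.
  exists (ext_class n_ge3 (Extension h0)) => e.
  have /asboolP hx := valP (repr e).
  (* The difference of two extensions is a cocycle, by the converse direction of the criterion for
     adding a field to [mn0]. *)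
  have [xi xiE] : exists xi : cocycle A n 2,
      cochain_val (cocycle_val xi) = ext_val (repr e) - mn0.
    move/asboolP: h0 => h0; have [v0 o0 _] := h0; have [v o _] := hx.
    apply: cocycle_ex; [exact: vector_fieldB|exact: has_orderB|].
    apply/(is_extension_addP n_ge3 m_A m_C h0); first exact: vector_fieldB.
      exact: has_orderB.
    by rewrite addrC subrK.
  exists (Harr_class xi); rewrite actE -[RHS]classK; apply/extP => /=.
  by rewrite xiE [mn0 + _]addrC subrK subrr; exact: exact_field0.
Qed.
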